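(* Let $H=\mathcal{P}(G,R,D)$ be the pointed Hopf algebra defined in the context, let $x$ be one of its skew-primitive generators $x_1,\dots,x_n$, and let $\chi$ be the corresponding character, so that $gx=\chi(g)xg$ for $g\in G$. Let $H$ act on a matrix algebra $A$ so that the associated $\widehat{G}$-grading of $A$ is mixed, and identify $A=M_d(\mathbb{F})\otimes\mathcal{D}$ as described in the context, with the associated data $T$, $X_\tau$ ($\tau\in T$), $f:G\to T$, $\sigma_1,\dots,\sigma_s\in\widehat{G}$ and $d=d_1+\dots+d_s$. Then the inner action of $H$ on $A$ can be chosen (via a convolution invertible map $u:H\to A$) so that $$u(g)=(\sigma_1(g)I_{d_1}\otimes X_{f(g)})\oplus\cdots\oplus(\sigma_s(g)I_{d_s}\otimes X_{f(g)})\quad\text{for all } g\in G,$$ $$u(x)=\sum_{\substack{1\le i,j\le s\\ \tau_{ij}\in T}}u_{ij}\otimes X_{\tau_{ij}},\qquad \tau_{ij}=\sigma_i^{-1}\sigma_j\chi,$$ where $u_{ij}$ is a matrix in $M_d(\mathbb{F})$ concentrated in the $(i,j)$th block with respect to the partition $d=d_1+\dots+d_s$. In each block row and in each block column of $u(x)$ there is at most one block different from zero.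
   Context: Let $\mathbb{F}$ be an algebraically closed field, $G$ a finite nontrivial abelian group of order not divisible by $\mathrm{char}\,\mathbb{F}$, $\widehat{G}=\mathrm{Hom}(G,\mathbb{F}^\times)$, $\varepsilon$ the trivial character. Let $a_1,\dots,a_n\in G$, $\chi_1,\dots,\chi_n\in\widehat{G}$ satisfy $q_i:=\chi_i(a_i)\neq1$ and $\chi_j(a_i)\chi_i(a_j)=1$ for $i\ne j$; let $N_i$ be the order of $q_i$ in $\mathbb{F}^\times$; let $\mu_i\in\{0,1\}$, $\lambda_{ij}\in\mathbb{F}$ ($i<j$) with $\mu_i=0$ if $a_i^{N_i}=1$ or $\chi_i^{N_i}\ne\varepsilon$, and $\lambda_{ij}=0$ if $a_ia_j=1$ or $\chi_i\chi_j\neq\varepsilon$. The Hopf algebra $\mathcal{P}(G,R,D)$ is generated by $G$ and $x_1,\dots,x_n$ subject to the relations of $G$ and $gx_i=\chi_i(g)x_ig$, $x_i^{N_i}=\mu_i(1-a_i^{N_i})$, $x_jx_i=\chi_i(a_j)x_ix_j+\lambda_{ij}(1-a_ia_j)$ ($i<j$), with $\Delta(g)=g\otimes g$ and $\Delta(x_i)=x_i\otimes1+a_i\otimes x_i$. An action of $H$ on $A$ is an $H$-module algebra structure $(h,b)\mapsto h*b$; it is inner via a convolution invertible linear $u:H\to A$ with $u(1)=1_A$ if $h*b=\sum u(h_{(1)})bu^{-1}(h_{(2)})$. The associated grading is $A=\bigoplus_{\varphi\in\widehat{G}}A_\varphi$, $A_\varphi=\{b: g*b=\varphi(g)b\ \forall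 g\in G\}$. By the known classification of gradings, $A\cong\mathrm{End}_{\mathcal{D}}(V)$ as a graded algebra, where $\mathcal{D}$ is a graded division algebra (nonzero homogeneous elements are invertible) that is simple as an algebra, and $V$ is a finite-dimensional graded right $\mathcal{D}$-module. The support $T$ of $\mathcal{D}$ is a subgroup of $\widehat{G}$, each component $\mathcal{D}_\tau=\mathbb{F}X_\tau$ is one-dimensional with $X_\tau^{o(\tau)}=I$, and $X_{\tau_2}X_{\tau_1}=\beta(\tau_2,\tau_1)X_{\tau_1}X_{\tau_2}$ for a nondegenerate alternating bicharacter $\beta:T\times T\to\mathbb{F}^\times$. The homomorphism $f:G\to T$ is defined by $\beta(f(g),\tau)=\tau(g)$ for all $\tau\in T$. Write $V=(V_{\sigma_1}\otimes\mathcal{D})\oplus\dots\oplus(V_{\sigma_s}\otimes\mathcal{D})$, where $\sigma_1,\dots,\sigma_s\in\widehat{G}$ are pairwise non-congruent modulo $T$, the elements of $V_{\sigma_i}$ have degree $\sigma_i$, and $\dim V_{\sigma_i}=d_i$. With $d=d_1+\dots+d_s$ this identifies $A$ with $M_d(\mathbb{F})\otimes\mathcal{D}$, where for a matrix unit $E$ in the $(i,j)$th block, $E\otimes X_\tau$ has degree $\sigma_i\sigma_j^{-1}\tau$. The grading is called elementary if $\mathcal{D}=\mathbb{F}$, division if $d=1$, and mixed if it is neither elementary nor division. *)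

(* Defs.v *)
From HB Require Import structures.
From mathcomp Require Import all_boot all_order all_algebra all_fingroup.
From mathcomp Require Import all_solvable.

Set Implicit Arguments.
Unset Strict Implicit.
Unset Printing Implicit Defensive.

Import GroupScope GRing.Theory.
Local Open Scope ring_scope.

Section Characters.

Variables (F : closedFieldType) (gT : finGroupType).

Definition is_char (chi : {ffun gT -> F}) : bool :=
  (chi 1%g == 1) && [forall g, forall h, chi (g * h)%g == chi g * chi h].

Record character := Character {char_val :> {ffun gT -> F}; _ : is_char char_val}.

HB.instance Definition _ := [isSub for char_val].
HB.instance Definition _ := [Choice of character by <:].

Lemma char1 (chi : character) : chi 1%g = 1.
Proof. by case: chi => c /= /andP[/eqP]. Qed.

Lemma charM (chi : character) g h : chi (g * h)%g = chi g * chi h.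
Proof. by case: chi => c /= /andP[_ /forallP/(_ g)/forallP/(_ h)/eqP]. Qed.

Lemma charV (chi : character) g : chi g * chi g^-1%g = 1.
Proof. by rewrite -charM mulgV char1. Qed.

(* The values of a character are roots of X^#|gT| - 1, so there are finitely
   many characters. *)
Definition char_roots : seq F := sval (closed_field_poly_normal ('X^#|gT| - 1 : {poly F})).

Lemma char_root (chi : character) g : chi g \in char_roots.
Proof.
rewrite /char_roots; case: closed_field_poly_normal => r /= Hr.
have cXn: lead_coef ('X^#|gT| - 1 : {poly F}) = 1.
  by apply/eqP; rewrite -[_ == _]/(_ \is monic) monicXnsubC // -cardsT cardG_gt0.
rewrite -root_prod_XsubC; move: Hr; rewrite cXn scale1r => <-.
rewrite rootE !hornerE subr_eq0.
have charX k : chi (g ^+ k)%g = chi g ^+ k.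
  by elim: k => [|k IH]; rewrite ?expg0 ?char1 ?expr0 // expgS charM IH exprS.
by rewrite -charX -cardsT expg_cardG ?inE // char1.
Qed.

Definition char_code (chi : character) : {ffun gT -> seq_sub char_roots} :=
  [ffun g => SeqSub (char_root chi g)].

Definition char_decode (c : {ffun gT -> seq_sub char_roots}) : option character :=
  insub [ffun g => ssval (c g)].

Lemma char_codeK : pcancel char_code char_decode.
Proof.
move=> chi; rewrite /char_decode.
suff -> : [ffun g => ssval (char_code chi g)] = val chi by rewrite valK.
by apply/ffunP=> g; rewrite !ffunE.
Qed.

HB.instance Definition _ := isCountable.Build character
  (pcan_pickleK char_codeK).
HB.instance Definition _ := isFinite.Build character (pcan_enumP char_codeK).

Lemma is_char_one : is_char [ffun=> 1].
Proof.
by rewrite /is_char !ffunE eqxx; do 2!apply/forallP=> ?; rewrite !ffunE mulr1.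
Qed.

Lemma is_char_mul (chi psi : character) : is_char [ffun g => chi g * psi g].
Proof.
rewrite /is_char !ffunE !char1 mulr1 eqxx; apply/forallP=> g; apply/forallP=> h.
by rewrite !ffunE !charM mulrACA.
Qed.

Lemma is_char_inv (chi : character) : is_char [ffun g => (chi g)^-1].
Proof.
rewrite /is_char !ffunE char1 invr1 eqxx; apply/forallP=> g; apply/forallP=> h.
by rewrite !ffunE charM invfM.
Qed.

Definition char_one := Character is_char_one.
Definition char_mul chi psi := Character (is_char_mul chi psi).
Definition char_inv chi := Character (is_char_inv chi).

Lemma char_mulA : associative char_mul.
Proof. by move=> a b c; apply/val_inj/ffunP=> g; rewrite !ffunE mulrA. Qed.

Lemma char_mul1 : left_id char_one char_mul.
Proof. by move=> a; apply/val_inj/ffunP=> g; rewrite !ffunE mul1r. Qed.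

Lemma char_mulV : left_inverse char_one char_inv char_mul.
Proof.
move=> a; apply/val_inj/ffunP=> g; rewrite !ffunE mulVf //.
by apply/eqP=> a0; move/eqP: (charV a g); rewrite a0 mul0r eq_sym oner_eq0.
Qed.

HB.instance Definition _ :=
  Finite_isGroup.Build character char_mulA char_mul1 char_mulV.

End Characters.

(* An element of U (x) V is represented by a list of pairs, standing for the
   sum of the corresponding pure tensors. By the universal property of the
   tensor product, two lists represent the same tensor when every bilinear
   map takes the same value on both; likewise for threefold tensors. *)
Definition tensor_eq (F : fieldType) (U V : lmodType F) (s t : seq (U * V)) :=
  forall (W : lmodType F) (f : U -> V -> W),
    (forall v, linear (f^~ v)) -> (forall u, linear (f u)) ->
  \sum_(p <- s) f p.1 p.2 = \sum_(p <- t) f p.1 p.2.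

Definition tensor3_eq (F : fieldType) (U V Z : lmodType F)
    (s t : seq (U * V * Z)) :=
  forall (W : lmodType F) (f : U -> V -> Z -> W),
    (forall v z, linear (fun u => f u v z)) ->
    (forall u z, linear (fun v => f u v z)) ->
    (forall u v, linear (f u v)) ->
  \sum_(p <- s) f p.1.1 p.1.2 p.2 = \sum_(p <- t) f p.1.1 p.1.2 p.2.

(* [comul h] is a list of pairs (h_(1), h_(2)), so that Sweedler's sum of
   f h_(1) h_(2) is [\sum_(p <- comul h) f p.1 p.2]. *)
Record hopf (F : fieldType) (H : algType F) := Hopf {
  comul : H -> seq (H * H);
  counit : {lrmorphism H -> F | *%R};
  antipode : {linear H -> H};
  comul_linear : forall (c : F) (h k : H),
    tensor_eq (comul (c *: h + k))
      ([seq (c *: p.1, p.2) | p <- comul h] ++ comul k);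
  comul1 : tensor_eq (comul 1) [:: (1, 1)];
  comulM : forall h k : H,
    tensor_eq (comul (h * k))
      [seq (p.1 * q.1, p.2 * q.2) | p <- comul h, q <- comul k];
  comulA : forall h : H,
    tensor3_eq [seq (q.1, q.2, p.2) | p <- comul h, q <- comul p.1]
               [seq (p.1, q.1, q.2) | p <- comul h, q <- comul p.2];
  counitl : forall h : H, \sum_(p <- comul h) counit p.1 *: p.2 = h;
  counitr : forall h : H, \sum_(p <- comul h) counit p.2 *: p.1 = h;
  antipodel : forall h : H,
    \sum_(p <- comul h) antipode p.1 * p.2 = (counit h)%:A;
  antipoder : forall h : H,
    \sum_(p <- comul h) p.1 * antipode p.2 = (counit h)%:A
}.

(* The order of q_i = chi_i(a_i) being N_i is expressed by [primitive_root].
   Only the values [dlambda i j] with i < j are meaningful. *)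
Record datum (F : closedFieldType) (gT : finGroupType) (n : nat) := Datum {
  da : 'I_n -> gT;
  dchi : 'I_n -> character F gT;
  dN : 'I_n -> nat;
  dmu : 'I_n -> F;
  dlambda : 'I_n -> 'I_n -> F;
  datum_q : forall i, dchi i (da i) != 1;
  datum_N : forall i, (dN i).-primitive_root (dchi i (da i));
  datum_cartan : forall i j : 'I_n, i != j -> dchi j (da i) * dchi i (da j) = 1;
  datum_mu : forall i, dmu i = 0 \/ dmu i = 1;
  datum_mu0 : forall i,
    (da i ^+ dN i = 1)%g \/ (dchi i ^+ dN i <> 1)%g -> dmu i = 0;
  datum_lambda0 : forall i j : 'I_n, (i < j)%N ->
    (da i * da j = 1)%g \/ (dchi i * dchi j <> 1)%g -> dlambda i j = 0
}.

Record P_relations (F : closedFieldType) (gT : finGroupType) (n : nat)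
    (D : datum F gT n) (B : algType F) (iota : gT -> B) (x : 'I_n -> B) :
    Prop := {
  P_one : iota 1%g = 1;
  P_mul : forall g h, iota (g * h)%g = iota g * iota h;
  P_conj : forall g i, iota g * x i = dchi D i g *: (x i * iota g);
  P_power : forall i,
    x i ^+ dN D i = dmu D i *: (1 - iota (da D i ^+ dN D i)%g);
  P_link : forall i j : 'I_n, (i < j)%N ->
    x j * x i = dchi D i (da D j) *: (x i * x j)
                + dlambda D i j *: (1 - iota (da D i * da D j)%g)
}.

(* The Hopf algebra H is P(G, R, D): as an algebra, it is presented by the
   generators g and x_i and the relations above. *)
Record is_P (F : closedFieldType) (gT : finGroupType) (n : nat)
    (D : datum F gT n) (H : algType F) (Hh : hopf H)
    (iota : gT -> H) (x : 'I_n -> H) : Prop := {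
  P_rel : P_relations D iota x;
  P_univ : forall (B : algType F) (iota' : gT -> B) (x' : 'I_n -> B),
    P_relations D iota' x' ->
    exists phi : {lrmorphism H -> B},
      [/\ forall g, phi (iota g) = iota' g,
          forall i, phi (x i) = x' i
        & forall psi : {lrmorphism H -> B},
            (forall g, psi (iota g) = iota' g) ->
            (forall i, psi (x i) = x' i) -> psi =1 phi];
  P_comul_g : forall g, tensor_eq (comul Hh (iota g)) [:: (iota g, iota g)];
  P_comul_x : forall i,
    tensor_eq (comul Hh (x i)) [:: (x i, 1); (iota (da D i), x i)]
}.

Record module_algebra (F : fieldType) (H : algType F) (Hh : hopf H)
    (A : algType F) (act : H -> A -> A) : Prop := {
  act_linearl : forall b, linear (act^~ b);
  act_linearr : forall h, linear (act h);
  act_one : forall b, act 1 b = b;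
  act_mul : forall h k b, act (h * k) b = act h (act k b);
  act_unit : forall h, act h 1 = (counit Hh h)%:A;
  act_prod : forall h b c,
    act h (b * c) = \sum_(p <- comul Hh h) act p.1 b * act p.2 c
}.

Definition conv_inverse (F : fieldType) (H : algType F) (Hh : hopf H)
    (A : algType F) (u v : H -> A) : Prop :=
  forall h, \sum_(p <- comul Hh h) u p.1 * v p.2 = (counit Hh h)%:A
         /\ \sum_(p <- comul Hh h) v p.1 * u p.2 = (counit Hh h)%:A.

Definition inner_via (F : fieldType) (H : algType F) (Hh : hopf H)
    (A : algType F) (act : H -> A -> A) (u : {linear H -> A}) : Prop :=
  u 1 = 1 /\
  exists v : {linear H -> A}, conv_inverse Hh u v /\
    forall h b, act h b = \sum_(p <- comul Hh h) u p.1 * b * v p.2.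

Definition homogeneous (F : closedFieldType) (gT : finGroupType)
    (H A : algType F) (act : H -> A -> A) (iota : gT -> H)
    (phi : character F gT) (b : A) : Prop :=
  forall g, act (iota g) b = phi g *: b.

(* [comp phi] is the component of degree phi. *)
Record grading (F : closedFieldType) (gT : finGroupType) (B : algType F)
    (comp : character F gT -> B -> Prop) : Prop := {
  comp_linear : forall phi (c : F) y z,
    comp phi y -> comp phi z -> comp phi (c *: y + z);
  comp_direct : forall y, exists! yy : {ffun character F gT -> B},
    (forall phi, comp phi (yy phi)) /\ y = \sum_phi yy phi;
  comp_one : comp 1%g 1;
  comp_mul : forall phi psi y z,
    comp phi y -> comp psi z -> comp (phi * psi)%g (y * z)
}.

Definition simple_algebra (F : fieldType) (B : algType F) : Prop :=
  forall I : B -> Prop,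
    (forall (c : F) y z, I y -> I z -> I (c *: y + z)) ->
    (forall y z, I y -> I (z * y) /\ I (y * z)) ->
    I 0 -> (forall y, I y -> y = 0) \/ (forall y, I y).

Record nondegenerate_alternating (F : closedFieldType) (gT : finGroupType)
    (T : {group character F gT})
    (beta : character F gT -> character F gT -> F) : Prop := {
  beta_neq0 : {in T &, forall s t, beta s t != 0};
  beta_mull : {in T & &, forall s t r,
    beta (s * t)%g r = beta s r * beta t r};
  beta_mulr : {in T & &, forall s t r,
    beta s (t * r)%g = beta s t * beta s r};
  beta_alt : {in T, forall t, beta t t = 1};
  beta_nondeg : {in T, forall s, {in T, forall t, beta s t = 1} -> s = 1%g}
}.

(* The values of X and beta outside of T are irrelevant. *)
Record graded_division (F : closedFieldType) (gT : finGroupType)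
    (D : algType F) (comp : character F gT -> D -> Prop)
    (T : {group character F gT}) (X : character F gT -> D)
    (beta : character F gT -> character F gT -> F) : Prop := {
  gd_grading : grading comp;
  gd_division : forall phi y, comp phi y -> y <> 0 ->
    exists z, y * z = 1 /\ z * y = 1;
  gd_simple : simple_algebra D;
  gd_support : forall phi, phi \in T <-> exists y, comp phi y /\ y <> 0;
  gd_comp : {in T, forall t y, comp t y <-> exists c : F, y = c *: X t};
  gd_order : {in T, forall t, X t ^+ #[t]%g = 1};
  gd_beta : nondegenerate_alternating T beta;
  gd_comm : {in T &, forall t2 t1, X t2 * X t1 = beta t2 t1 *: (X t1 * X t2)}
}.

(* M_d(F) (x) D is realized as the algebra of d x d matrices with entries in D;
   E (x) X is then the matrix with entries E_ij X. *)
Definition tens (F : fieldType) (D : algType F) (m n : nat)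
    (E : 'M[F]_(m, n)) (X : D) : 'M[D]_(m, n) :=
  \matrix_(i, j) (E i j *: X).

Definition in_block (F : fieldType) (s : nat) (d : 'I_s -> nat)
    (i j : 'I_s) (E : 'M[F]_(\sum_(l < s) d l)) : Prop :=
  forall k l, (k, l) != (i, j) -> submxblock E k l = 0.

(* Psi identifies M_d(F) (x) D, where d = \sum_i d_i, with the graded algebra A:
   it is an isomorphism of F-algebras, and for any matrix unit E in the (i,j)th
   block, E (x) X_tau has degree sigma_i sigma_j^-1 tau. *)
Record identification (F : closedFieldType) (gT : finGroupType)
    (H A : algType F) (act : H -> A -> A) (iota : gT -> H)
    (D : algType F) (T : {group character F gT}) (X : character F gT -> D)
    (s : nat) (sigma : 'I_s -> character F gT) (d : 'I_s -> nat)
    (Psi : 'M[D]_(\sum_(i < s) d i) -> A) : Prop := {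
  Psi_bij : bijective Psi;
  Psi_linear : forall (c : F) M N,
    Psi (map_mx ( *:%R c) M + N) = c *: Psi M + Psi N;
  Psi_one : Psi 1%:M = 1;
  Psi_mul : forall M N, Psi (M *m N) = Psi M * Psi N;
  Psi_degree : forall i j (p : 'I_(d i)) (q : 'I_(d j)), {in T, forall t,
    homogeneous act iota (sigma i * (sigma j)^-1 * t)%g
      (Psi (tens (delta_mx (tagnat.Rank i p) (tagnat.Rank j q)) (X t)))}
}.

Definition elementary (F : fieldType) (D : algType F) : Prop :=
  forall y : D, exists c : F, y = c%:A.

(* Main.v *)
Require Import Defs.
From HB Require Import structures.
From mathcomp Require Import all_boot all_order all_algebra all_fingroup.
From mathcomp Require Import boolp ring.
From Stdlib Require Import Classical.

(** Each h of H acts on A = M_d(F) (x) D; a linear u with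
    u(h) b = sum (h_(1) * b) u(h_(2)) and a convolution inverse makes the action
    inner. On a group-like g, u(g) is the given block diagonal element, because
    conjugation by it multiplies the degree phi component by phi(g). If h has
    coproduct h (x) g + g' (x) h + (terms where u is known), the condition on
    u(h) says that a certain skew derivation of the matrix algebra A is inner,
    hence it can be met. All monomials in the x_i and G have such coproducts
    modulo shorter monomials, so u extends from G (or from G and one x) to H.
    For h = x, averaging over G makes u(x) homogeneous of degree chi, which
    gives the block form; the sigma_i being distinct modulo T gives one block
    per row and column. Prescribing u freely on G requires the elements of G to be
    linearly independent in H, which is seen on the representation of H induced
    from the regular representation of G. *)

Set Implicit Arguments.
Unset Strict Implicit.
Unset Printing Implicit Defensive.

Import GroupScope GRing.Theory.
Local Open Scope ring_scope.

(** Innerness involves both [u] and its inverse, while [u(h) b = sum (h_(1) * b) u(h_(2))] is linear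
    in [u] and can be solved one monomial at a time; the same scheme then yields the inverse,
    because [u] is invertible on group-likes. The obstacle is that [H] is given by its universal
    property only, so a monomial may depend linearly on earlier ones. The solution therefore lives
    on a growing subcoalgebra [E]: a monomial in [E] already satisfies the equation, and for one
    outside [E] a linear functional vanishing on [E] lets its value be prescribed. What must be
    known is that [G] is linearly independent and that [x] lies outside the span of [G] unless it is
    zero. The representation showing the independence of [G] is induced along one generator at a
    time, with powers [x_r ^ l], [l < N_r]. The conditions on [mu] and [lambda] make the relations
    survive each such step, and the q-numbers that arise vanish at [N_r] and [N_i]. Since
    [x_i ^ N_i] lies in the group algebra, words of bounded length span [H], so finitely many
    extension steps suffice. *)

Definition mk_linear (F : fieldType) (U V : lmodType F) (f : U -> V) (lf : linear f) :
  {linear U -> V} := HB.pack f (GRing.isLinear.Build F U V *:%R f lf).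

(** * Characters and the datum *)

Section CharacterFacts.
Variables (F : closedFieldType) (gT : finGroupType).
Implicit Types (chi psi : character F gT) (g h : gT).

Lemma char_neq0 chi g : chi g != 0.
Proof.
by apply/eqP=> c0; move/eqP: (Defs.charV chi g); rewrite c0 mul0r eq_sym oner_eq0.
Qed.

Lemma charX chi g k : chi (g ^+ k)%g = chi g ^+ k.
Proof. by elim: k => [|k IH]; rewrite ?expg0 ?Defs.char1 ?expr0 // expgS Defs.charM IH exprS. Qed.

Lemma char_mulE chi psi g : (chi * psi)%g g = chi g * psi g.
Proof. by rewrite ffunE. Qed.

Lemma char_invE chi g : chi^-1%g g = (chi g)^-1.
Proof. by rewrite ffunE. Qed.

Lemma char_oneE g : (1%g : character F gT) g = 1.
Proof. by rewrite ffunE. Qed.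

Lemma char_expE chi k g : (chi ^+ k)%g g = chi g ^+ k.
Proof.
by elim: k => [|k IH]; rewrite ?expg0 ?char_oneE ?expr0 // expgS char_mulE IH exprS.
Qed.

Lemma charP chi psi : (forall g, chi g = psi g) -> chi = psi.
Proof. by move=> e; apply/val_inj/ffunP. Qed.

End CharacterFacts.

Section DatumFacts.
Variables (F : closedFieldType) (gT : finGroupType) (n : nat) (D : datum F gT n).

Lemma dN_gt0 i : (0 < dN D i)%N.
Proof. exact: prim_order_gt0 (datum_N D i). Qed.

(** The q-number [[N_i]] at [q_i] vanishes. This closes the truncation at [x_r ^ N_r] and lets
    [x_i ^ N_i] pass [x_r] without a linking term. *)
Lemma dN_geom i : \sum_(t < dN D i) dchi D i (da D i) ^+ t = 0.
Proof.
have := subrX1 (dchi D i (da D i)) (dN D i).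
rewrite (prim_expr_order (datum_N D i)) subrr => /esym/eqP.
by rewrite mulf_eq0 subr_eq0 (negPf (datum_q D i)) => /eqP.
Qed.

(** A nonzero [mu_i] makes [chi_i ^ N_i] trivial, and [chi_j(a_i) chi_i(a_j) = 1] carries this over
    to [chi_j]. So [a_i ^ N_i] commutes with every [x_j] whenever it occurs in a power relation. *)
Lemma dmu_char i j : dmu D i != 0 -> dchi D j (da D i) ^+ dN D i = 1.
Proof.
move=> mu0; have [->|ji] := eqVneq j i.
  exact: prim_expr_order (datum_N D i).
have Xi: (dchi D i ^+ dN D i = 1)%g.
  by apply: NNPP => h; case/eqP: mu0; apply: datum_mu0; right.
have := congr1 (fun chi : character F gT => chi (da D j)) Xi.
rewrite char_expE char_oneE => e.
by rewrite -[LHS]mulr1 -{1}e -exprMn datum_cartan ?expr1n // eq_sym.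
Qed.

Lemma dmu_char_all i g : dmu D i != 0 -> dchi D i g ^+ dN D i = 1.
Proof.
move=> mu0; rewrite -char_expE.
suff -> : (dchi D i ^+ dN D i = 1)%g by rewrite char_oneE.
by apply: NNPP => h; case/eqP: mu0; apply: datum_mu0; right.
Qed.

Lemma dlambda_char (i j : 'I_n) g : (i < j)%N -> dlambda D i j != 0 ->
  dchi D i g * dchi D j g = 1.
Proof.
move=> ij l0; rewrite -char_mulE.
suff -> : (dchi D i * dchi D j = 1)%g by rewrite char_oneE.
by apply: NNPP => h; case/eqP: l0; apply: datum_lambda0 => //; right.
Qed.

(** By the same transfer, [a_i a_j] commutes with every other [x_l] whenever it occurs in a linking
    relation. *)
Lemma dlambda_char3 (i j l : 'I_n) : (i < j)%N -> dlambda D i j != 0 ->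
  l != i -> l != j -> dchi D l (da D i) * dchi D l (da D j) = 1.
Proof.
move=> ij l0 li lj; rewrite -[LHS]mul1r -(dlambda_char (da D l) ij l0) mulrACA.
by rewrite !datum_cartan ?mulr1 ?dlambda_char // eq_sym.
Qed.

End DatumFacts.

(** * The induced representation *)

Section FfunOps.
Variables (F : fieldType) (V : vectType F) (N : nat).
Local Notation V' := {ffun 'I_N -> V}.

Definition single (l : nat) (m : V) : V' := [ffun j : 'I_N => if j == l :> nat then m else 0].

Lemma single_linear l : linear (single l).
Proof.
move=> c u v; apply/ffunP=> j; rewrite !ffunE.
by case: ifP => _; rewrite ?scaler0 ?addr0.
Qed.
HB.instance Definition _ l := GRing.isLinear.Build F V V' *:%R (single l) (@single_linear l).

Definition op_of (T : nat -> {linear V -> V'}) (m : V') : V' := \sum_(l < N) T l (m l).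

Lemma op_of_linear T : linear (op_of T).
Proof.
move=> c u v; rewrite /op_of scaler_sumr -big_split; apply: eq_bigr => l _.
by rewrite !ffunE linearP.
Qed.
HB.instance Definition _ T := GRing.isLinear.Build F V' V' *:%R (op_of T) (@op_of_linear T).

Lemma op_single T l m : (l < N)%N -> op_of T (single l m) = T l m.
Proof.
move=> lN; rewrite /op_of (bigD1 (Ordinal lN)) //= big1 ?addr0 => [|j jl].
  by rewrite ffunE /= eqxx.
by rewrite ffunE ifN ?linear0.
Qed.

Lemma single_ext (f g : V' -> V') :
    {morph f : u v / u + v} -> {morph g : u v / u + v} ->
    (forall l m, (l < N)%N -> f (single l m) = g (single l m)) -> f =1 g.
Proof.
move=> fD gD fg u.
have f0: f 0 = 0 by apply: (addrI (f 0)); rewrite -fD !addr0.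
have g0: g 0 = 0 by apply: (addrI (g 0)); rewrite -gD !addr0.
have -> : u = \sum_(l < N) single l (u l).
  apply/ffunP=> j; rewrite sum_ffunE (bigD1 j) //= big1 ?addr0.
    by rewrite ffunE eqxx.
  by move=> i ij; rewrite ffunE ifN // eq_sym.
rewrite (big_morph f fD f0) (big_morph g gD g0).
by apply: eq_bigr => l _; apply: fg.
Qed.
End FfunOps.

Lemma sub_linearD (F : fieldType) (V : vectType F) (f : {linear V -> V}) (c : F) u w :
  c *: (u + w - f (u + w)) = c *: (u - f u) + c *: (w - f w).
Proof. by rewrite [f _]linearD opprD addrACA scalerDr. Qed.

Lemma scale_sub_split (F : fieldType) (V : lmodType F) (c1 c2 c3 c4 c d : F) (u w : V) :
  c = c1 - c3 -> d = c2 - c4 ->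
  c *: u - d *: w = c1 *: u - c2 *: w - (c3 *: u - c4 *: w).
Proof. by move=> -> ->; rewrite !scalerBl !opprB addrACA [RHS]addrACA; congr (_ + _); rewrite addrC. Qed.

Lemma geom_recl (F : fieldType) (z : F) l :
  \sum_(s < l.+1) z ^+ s = 1 + z * \sum_(s < l) z ^+ s.
Proof.
rewrite big_ord_recl expr0; congr (_ + _); rewrite mulr_sumr.
by apply: eq_bigr => t _; rewrite exprS.
Qed.

Section PartialReps.
Variables (F : closedFieldType) (gT : finGroupType) (n : nat) (D : datum F gT n).
Hypothesis gT_abelian : abelian [set: gT].

Local Notation chi := (dchi D).
Local Notation a := (da D).
Local Notation N := (dN D).

(* Only the first [r] generators are required to satisfy the relations. *)
Record partial_rep (r : nat) (V : vectType F)
    (I : gT -> {linear V -> V}) (Y : 'I_n -> {linear V -> V}) : Prop := {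
  pr_one : forall v, I 1%g v = v;
  pr_mul : forall g h v, I (g * h)%g v = I g (I h v);
  pr_conj : forall g (i : 'I_n) v, (i < r)%N -> I g (Y i v) = chi i g *: Y i (I g v);
  pr_pow : forall (i : 'I_n) v, (i < r)%N ->
    iter (N i) (Y i) v = dmu D i *: (v - I (a i ^+ N i)%g v);
  pr_link : forall (i j : 'I_n) v, (i < j)%N -> (j < r)%N ->
    Y j (Y i v) = chi i (a j) *: Y i (Y j v)
      + dlambda D i j *: (v - I (a i * a j)%g v)
}.

Lemma gT_mulC (g h : gT) : (g * h = h * g)%g.
Proof. by apply: (centsP gT_abelian); rewrite inE. Qed.

(* The representation of the first [r + 1] generators induced from one of the first
   [r]: [single l m] stands for [x_r ^ l (x) m] with [l < N_r]. *)
Section Step.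
Variables (V : vectType F) (I : gT -> {linear V -> V}) (Y : 'I_n -> {linear V -> V}).
Variables (r : 'I_n).
Hypothesis rep : partial_rep r I Y.

Local Notation Nr := (N r).
Local Notation q := (chi r (a r)).
Local Notation p i := (chi i (a r)).
Local Notation lam i := (dlambda D i r).
Local Notation K i := (I (a i * a r)%g).
Local Notation br l := (\sum_(t < l) q ^+ t).
Local Notation V' := {ffun 'I_(dN D r) -> V}.
Local Notation single := (@single F V (dN D r)).

(** From [g x_r ^ l = chi_r(g) ^ l x_r ^ l g]. The operator [indX] below raises the exponent and
    wraps round at [N_r] by the power relation. *)
Definition indI g : {linear V' -> V'} :=
  locked (op_of (fun l => (chi r g ^+ l \*: (single l \o I g)) : {linear V -> V'})
    : {linear V' -> V'}).
Definition indX : {linear V' -> V'} :=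
  locked (op_of (fun l => if (l.+1 < Nr)%N then single l.+1 : {linear V -> V'}
    else single 0%N \o (dmu D r \*: (idfun \- I (a r ^+ Nr)%g))) : {linear V' -> V'}).
(* Obtained by moving [x_i] to the right through [x_r ^ l] with the linking relation.
   The coefficients vanish unless [chi_i chi_r = 1], so they are written in terms of
   [q] only, using [p i = q^-1] in that case. *)
Definition indY i : {linear V' -> V'} :=
  locked (op_of (fun l => (p i ^- l \*: (single l \o Y i))
    \- (single l.-1 \o ((lam i * q * br l \*: idfun) \- (lam i * q ^+ l * br l \*: K i)))) : {linear V' -> V'}).
Definition ind_gen i : {linear V' -> V'} := if i == r then indX else indY i.

Lemma indI_single g l m : (l < Nr)%N -> indI g (single l m) = chi r g ^+ l *: single l (I g m).
Proof. by move=> lN; rewrite /indI -lock; apply: etrans (op_single _ _ lN) _. Qed.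

Lemma indX_single l m : (l.+1 < Nr)%N -> indX (single l m) = single l.+1 m.
Proof. by move=> lN; rewrite /indX -lock; apply: etrans (op_single _ _ (ltnW lN)) _; rewrite lN. Qed.

Lemma indX_last l m : (l.+1 = Nr)%N ->
  indX (single l m) = dmu D r *: single 0 (m - I (a r ^+ Nr)%g m).
Proof.
move=> lN; have h : (l < Nr)%N by rewrite -lN.
by rewrite /indX -lock; apply: etrans (op_single _ _ h) _; rewrite lN ltnn /= linearZ.
Qed.

Lemma indY_single i l m : (l < Nr)%N -> indY i (single l m) = p i ^- l *: single l (Y i m)
  - single l.-1 (lam i * q * br l *: m - lam i * q ^+ l * br l *: K i m).
Proof. by move=> lN; rewrite /indY -lock; apply: etrans (op_single _ _ lN) _. Qed.

Lemma single_sub l c d m m' : single l (c *: m - d *: m') = c *: single l m - d *: single l m'.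
Proof. by rewrite linearB !linearZ. Qed.

(** A nonzero linking parameter makes [chi_i chi_r] trivial, so the scalars of the induced action
    become powers of [q]. *)
Lemma link_scalars (i : 'I_n) : (i < r)%N -> lam i != 0 -> p i = q^-1 /\ chi r (a i) = q.
Proof.
move=> ir l0; have h g := dlambda_char g ir l0.
have e: p i * q = 1 by apply: h.
have q0 : q != 0 := char_neq0 _ _.
have pi : p i = q^-1 by apply: (mulIf q0); rewrite e mulVf.
split => //.
have := datum_cartan D (_ : r != i); rewrite pi => /(_ _)/=.
have ri: r != i by rewrite eq_sym neq_ltn ir.
by move/(_ ri) => e2; apply: (mulfI (invr_neq0 q0)); rewrite e2 mulVf.
Qed.

Lemma indI_one v : indI 1%g v = v.
Proof.
apply: (single_ext (f := indI 1%g) (g := id)) => [u w|u w|l m lN]; rewrite ?linearD //.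
by rewrite indI_single // Defs.char1 expr1n scale1r (pr_one rep).
Qed.

Lemma indI_mul g h v : indI (g * h)%g v = indI g (indI h v).
Proof.
apply: (single_ext (g := fun v => indI g (indI h v))) => [u w|u w|l m lN]; rewrite ?linearD //.
by rewrite !indI_single // linearZ /= indI_single // scalerA Defs.charM exprMn mulrC (pr_mul rep).
Qed.

Lemma indX_conj g v : indI g (indX v) = chi r g *: indX (indI g v).
Proof.
apply: (single_ext (f := fun v => indI g (indX v)) (g := fun v => chi r g *: indX (indI g v)))
  => [u w|u w|l m lN]; rewrite ?linearD //= ?scalerDr //.
rewrite indI_single // linearZ scalerA -exprS /=.
case: (ltnP l.+1 Nr) => [l1|l1]; first by rewrite !indX_single // indI_single.
have {}l1: l.+1 = Nr by apply/eqP; rewrite eqn_leq lN l1.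
rewrite !indX_last // !linearZ /= indI_single ?(dN_gt0 D) // expr0 scale1r scalerA l1.
rewrite linearB -!(pr_mul rep) gT_mulC.
(* The wrap-around picks up [chi_r(g) ^ N_r], which is 1 unless [mu_r = 0]. *)
have [->|mu0] := eqVneq (dmu D r) 0; first by rewrite mul0r !scale0r.
by rewrite dmu_char_all // mulr1.
Qed.

Lemma iter_morphD (W : vectType F) (f : {linear W -> W}) k : {morph iter k f : u v / u + v}.
Proof. by elim: k => [|k IH] u v //=; rewrite IH linearD. Qed.

Lemma iter_Z (W : vectType F) (f : {linear W -> W}) k c u : iter k f (c *: u) = c *: iter k f u.
Proof. by elim: k => [|k IH] //=; rewrite IH linearZ. Qed.

Lemma iter_indX k l m : (l + k < Nr)%N -> iter k indX (single l m) = single (l + k) m.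
Proof.
elim: k => [|k IH] /=; first by rewrite addn0.
by rewrite addnS => h; rewrite IH ?(ltnW h) // indX_single.
Qed.

Lemma indX_pow v : iter Nr indX v = dmu D r *: (v - indI (a r ^+ Nr)%g v).
Proof.
apply: (single_ext (f := iter Nr indX) (g := fun v => dmu D r *: (v - indI (a r ^+ Nr)%g v)))
  => [u w|u w|l m lN]; first exact: iter_morphD.
  exact: sub_linearD.
(* Here [N_r = l + 1 + (N_r - l - 1)]: climb to the top exponent, wrap round once, and climb back to
   [l]. *)
have -> : iter Nr indX (single l m) = iter l indX (indX (iter (Nr - l.+1) indX (single l m))).
  by rewrite -iterS -iterD; congr iter; rewrite addnS -addSn subnKC.
have e : (l + (Nr - l.+1)).+1 = Nr by rewrite -addSn subnKC.
rewrite iter_indX; last by rewrite -[ltnRHS]e ltnS.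
rewrite indX_last // iter_Z iter_indX ?add0n // indI_single // linearB /= charX.
by rewrite (prim_expr_order (datum_N D r)) expr1n scale1r.
Qed.

Lemma indY_conj g (i : 'I_n) v : (i < r)%N -> indI g (indY i v) = chi i g *: indY i (indI g v).
Proof.
move=> ir.
apply: (single_ext (f := fun v => indI g (indY i v)) (g := fun v => chi i g *: indY i (indI g v)))
  => [u w|u w|l m lN]; rewrite ?linearD //= ?scalerDr //.
have lN' : (l.-1 < Nr)%N by apply: leq_ltn_trans lN; rewrite leq_pred.
rewrite indI_single // linearZ scalerA /= !indY_single // !linearB !linearZ /= !indI_single //.
rewrite (pr_conj rep) // [single l (_ *: _)]linearZ /= !(scalerN, opprK, scalerDr) !scalerA.
rewrite -!(pr_mul rep) (gT_mulC g); congr (_ *: _ + _); first by ring.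
have [->|l0] := eqVneq (lam i) 0; first by rewrite !(mul0r, mulr0, scale0r).
(* At [l = 0] the truncated [l.-1] is harmless because the q-number is 0; for larger [l],
   [chi_i chi_r = 1] lowers the exponent of [chi_r(g)] by one. *)
case: l lN lN' => [|l] lN lN' /=; first by rewrite big_ord0 !(mulr0, mul0r, scale0r).
have e := dlambda_char g ir l0.
have E c : chi i g * chi r g ^+ l.+1 * c = c * chi r g ^+ l.
  by rewrite exprS mulrA e mul1r mulrC.
by rewrite !E.
Qed.

Lemma brS l : br l.+1 = br l + q ^+ l.
Proof. by rewrite big_ord_recr. Qed.
Lemma indX_indY (i : 'I_n) v : (i < r)%N ->
  indX (indY i v) = p i *: indY i (indX v) + lam i *: (v - indI (a i * a r)%g v).
Proof.
move=> ir.
apply: (single_ext (f := fun v => indX (indY i v))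
   (g := fun v => p i *: indY i (indX v) + lam i *: (v - indI (a i * a r)%g v)))
  => [u w|u w|l m lN]; first by rewrite !linearD.
  by rewrite sub_linearD !linearD addrACA.
have p0 : p i != 0 := char_neq0 _ _.
have q0 : q != 0 := char_neq0 _ _.
rewrite indI_single // indY_single // linearB linearZ /=.
have -> : indX (single l.-1 (lam i * q * br l *: m - lam i * q ^+ l * br l *: K i m)) =
   single l (lam i * q * br l *: m - lam i * q ^+ l * br l *: K i m).
  case: l lN => [|l] lN; last by rewrite indX_single.
  by rewrite big_ord0 !mulr0 !scale0r subrr !linear0.
(* The correction term at [l] comes from the one at [l + 1]: [[l + 1] = 1 + q [l]] handles the
   coefficient of [m], and [[l + 1] = [l] + q ^ l] that of [K i m]. *)
have key : single l (lam i * q * br l *: m - lam i * q ^+ l * br l *: K i m)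
   = p i *: single l (lam i * q * br l.+1 *: m - lam i * q ^+ l.+1 * br l.+1 *: K i m)
    - lam i *: (single l m - chi r (a i * a r)%g ^+ l *: single l (K i m)).
  rewrite !single_sub !scalerBr !scalerA.
  have [->|l0] := eqVneq (lam i) 0.
    by rewrite !(mul0r, mulr0, scale0r, subr0).
  have [-> eq] := link_scalars ir l0.
  apply: scale_sub_split; first by rewrite geom_recl; field.
  by rewrite Defs.charM eq brS exprS exprMn; field.
case: (ltnP l.+1 Nr) => [l1|l1].
  have pl : p i ^- l = p i * p i ^- l.+1 by rewrite exprS invfM mulrA mulfV // mul1r.
  rewrite !indX_single // indY_single //= key [in RHS]scalerBr [p i *: (p i ^- l.+1 *: _)]scalerA -pl.
  by rewrite opprB addrA addrAC.
have {}l1: l.+1 = Nr by apply/eqP; rewrite eqn_leq lN l1.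
(* At the top exponent [[N_r] = 0] leaves only the linking term, so [x_i] has to commute with the
   wrap-around; this needs [chi_i(a_r) ^ N_r = 1], true unless [mu_r = 0]. *)
have br0 : br l.+1 = 0 by rewrite l1 dN_geom.
rewrite key br0 !mulr0 !scale0r subrr linear0 scaler0 sub0r opprK; congr (_ + _).
rewrite !indX_last // [indY i _]linearZ /= indY_single ?(dN_gt0 D) //.
rewrite big_ord0 !mulr0 !scale0r subrr linear0 subr0 expr0 invr1 scale1r !scalerA.
have [->|mu0] := eqVneq (dmu D r) 0; first by rewrite !mulr0 !scale0r.
have pN : p i ^+ Nr = 1 by apply: dmu_char.
rewrite (pr_conj rep) // charX pN scale1r -linearB; congr (_ *: _).
have : p i * p i ^+ l = 1 by rewrite -exprS l1.
by move=> e; rewrite -[p i in RHS]mulr1 -{1}(mulfV (expf_neq0 l p0)) mulrA e mul1r mulrC.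
Qed.

Lemma indX_indI g v : indX (indI g v) = (chi r g)^-1 *: indI g (indX v).
Proof. by rewrite indX_conj scalerA mulVf ?scale1r // char_neq0. Qed.

(** Moving [x_r] through a power of [x_i] accumulates q-numbers at [q_i]; they vanish for the
    exponent [N_i], which is how the power relation for [x_i] is obtained next. *)
Lemma indX_iter_indY (i : 'I_n) t v : (i < r)%N ->
  let qi := chi i (a i) in
  indX (iter t.+1 (indY i) v) = p i ^+ t.+1 *: iter t.+1 (indY i) (indX v)
    + ((lam i * \sum_(s < t.+1) qi ^+ s) *: iter t (indY i) v
    - (lam i * qi ^+ t * \sum_(s < t.+1) qi ^+ s) *: iter t (indY i) (indI (a i * a r)%g v)).
Proof.
move=> ir qi; elim: t v => [|t IH] v.
  by rewrite big_ord1 !expr0 expr1 !mulr1 -scalerBr; exact: indX_indY.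
rewrite iterSr IH indX_indY // iter_morphD !iter_Z scalerDr scalerA -exprSr -addrA.
rewrite -[iter t.+1 _ (indY i _)]iterSr; congr (_ + _).
rewrite indY_conj // iter_Z -!iterSr iter_morphD -scaleN1r iter_Z scaleN1r.
rewrite scalerBr scalerBr !scalerA addrACA -opprD -!scalerDl.
have [->|l0] := eqVneq (lam i) 0; first by rewrite !(mulr0, mul0r, addr0).
have [e1 e2] := link_scalars ir l0.
have q0 : q != 0 := char_neq0 _ _.
(* Since [chi_i chi_r = 1], [q_i] is inverse to [chi_r(a_i) = q], hence equals [chi_i(a_r)]. *)
have e3 : qi = p i by rewrite e1; apply: (mulIf q0); rewrite mulVf // -e2 dlambda_char.
congr (_ *: _ - _ *: _).
  by rewrite [in RHS]big_ord_recr /= e3 mulrDr addrC mulrC [X in _ = _ + X]mulrC.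
by rewrite Defs.charM -/qi [in RHS]geom_recl e3 exprS; ring.
Qed.

(** By [comm], [x_i ^ N_i] commutes with [x_r] up to a nonzero scalar, so the relation passes from
    [x_r ^ l (x) m] to [x_r ^ (l + 1) (x) m]; at [l = 0] it is the relation on [V]. *)
Lemma indY_pow (i : 'I_n) v : (i < r)%N ->
  iter (N i) (indY i) v = dmu D i *: (v - indI (a i ^+ N i)%g v).
Proof.
move=> ir.
have comm u : indX (iter (N i) (indY i) u) = p i ^+ N i *: iter (N i) (indY i) (indX u).
  rewrite -(prednK (dN_gt0 D i)) indX_iter_indY // prednK ?dN_gt0 //.
  by rewrite dN_geom !mulr0 !scale0r subrr addr0.
have p0 : p i ^+ N i != 0 by rewrite expf_neq0 // char_neq0.
apply: (single_ext (f := iter (N i) (indY i)) (g := fun v => dmu D i *: (v - indI (a i ^+ N i)%g v)))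
  => [u w|u w|l m]; [exact: iter_morphD|exact: sub_linearD|].
elim: l => [|l IH] lN.
  have it k : iter k (indY i) (single 0 m) = single 0 (iter k (Y i) m).
    elim: k => [|k IH] //=; rewrite IH indY_single // big_ord0 !mulr0 !scale0r subrr linear0.
    by rewrite subr0 expr0 invr1 scale1r.
  by rewrite it (pr_pow rep) // linearZ linearB /= indI_single // expr0 scale1r.
rewrite -indX_single //; apply: (scalerI p0).
rewrite -comm IH ?(ltnW lN) // linearZ linearB /= indX_indI.
have [->|mu0] := eqVneq (dmu D i) 0; first by rewrite !scale0r scaler0.
have ri: r != i by rewrite eq_sym neq_ltn ir.
by rewrite dmu_char_all // charX (dmu_char _ mu0) invr1 !scale1r.
Qed.

(** Induction on the exponent of [x_r]. Moving [x_r] through [x_j x_i] and through [x_i x_j] reduces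
    the relation at [x_r u] to the one at [u], provided that the linking terms created on the way
    agree. *)
Lemma indY_link (i j : 'I_n) v : (i < j)%N -> (j < r)%N ->
  indY j (indY i v) = chi i (a j) *: indY i (indY j v)
      + dlambda D i j *: (v - indI (a i * a j)%g v).
Proof.
move=> ij jr; have ir := ltn_trans ij jr.
apply: (single_ext (f := fun v => indY j (indY i v)) (g := fun v => chi i (a j) *: indY i (indY j v)
      + dlambda D i j *: (v - indI (a i * a j)%g v)))
  => [u w|u w|l m]; [by rewrite !linearD|by rewrite sub_linearD !linearD addrACA|].
elim: l => [|l IH] lN.
  have it k u : indY k (single 0 u) = single 0 (Y k u).
    rewrite indY_single // big_ord0 !mulr0 !scale0r subrr linear0.
    by rewrite subr0 expr0 invr1 scale1r.
  by rewrite !it (pr_link rep) // linearD !linearZ linearB /= indI_single // expr0 scale1r.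
rewrite -indX_single //; move: (single l m) (IH (ltnW lN)) => u {}IH.
have pi0 : p i != 0 := char_neq0 _ _.
have pj0 : p j != 0 := char_neq0 _ _.
have ri: r != i by rewrite eq_sym neq_ltn ir.
have rj: r != j by rewrite eq_sym neq_ltn jr.
have ji: j != i by rewrite eq_sym neq_ltn ij.
have c0 : p i * p j != 0 by rewrite mulf_neq0.
set lij := dlambda D i j; set x := chi i (a j).
(* These are the linking terms created by [x_r]. Their group elements can be moved next to [u],
   since [a_j a_r] commutes with [x_i] when [lam j] is nonzero, and [a_i a_r] with [x_j] when
   [lam i] is. *)
set Ai := indY i u - indY i (indI (a j * a r)%g u).
set Aj := indY j u - indY j (indI (a i * a r)%g u).
have hj : lam j *: (indY i u - indI (a j * a r)%g (indY i u)) = lam j *: Ai.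
  have [->|l0] := eqVneq (lam j) 0; first by rewrite !scale0r.
  by rewrite indY_conj // Defs.charM dlambda_char3 ?scale1r // eq_sym.
have hi : lam i *: (indY j u - indI (a i * a r)%g (indY j u)) = lam i *: Aj.
  have [->|l0] := eqVneq (lam i) 0; first by rewrite !scale0r.
  by rewrite indY_conj // Defs.charM dlambda_char3 ?scale1r // eq_sym.
have E1 : indX (indY j (indY i u)) = (p i * p j) *: indY j (indY i (indX u))
    + ((p j * lam i) *: Aj + lam j *: Ai).
  rewrite indX_indY // indX_indY // linearD !linearZ linearB /= scalerDr !scalerA hj.
  by rewrite addrA [p j * p i]mulrC.
have E0 : indX (indY i (indY j u)) = (p i * p j) *: indY i (indY j (indX u))
      + ((p i * lam j) *: Ai + lam i *: Aj).
  rewrite indX_indY // indX_indY // linearD !linearZ linearB /= scalerDr !scalerA hi.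
  by rewrite addrA.
clearbody Ai Aj.
(* The linking terms agree with those of [E1] because [chi_i(a_j) chi_i(a_r) = 1] when [lam j] is
   nonzero, and [chi_i(a_j) = chi_j(a_r)] when [lam i] is. *)
have E2 : x *: indX (indY i (indY j u)) = (p i * p j * x) *: indY i (indY j (indX u))
    + (lam j *: Ai + (p j * lam i) *: Aj).
  rewrite E0 !scalerDr !scalerA mulrC; congr (_ + (_ *: _ + _ *: _)).
    have [->|l0] := eqVneq (lam j) 0; first by rewrite !mulr0.
    by rewrite mulrA dlambda_char3 ?mul1r // eq_sym.
  have [->|l0] := eqVneq (lam i) 0; first by rewrite !mulr0.
  congr (_ * _); apply: (mulIf (char_neq0 (chi r) (a j))).
  by rewrite dlambda_char // datum_cartan // eq_sym.
have E3 : lij *: (indX u - indX (indI (a i * a j)%g u)) =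
    (p i * p j * lij) *: (indX u - indI (a i * a j)%g (indX u)).
  have [->|l0] := eqVneq lij 0; first by rewrite !mulr0 !scale0r.
  by rewrite dlambda_char // mul1r indX_indI Defs.charM dlambda_char3 // invr1 scale1r linearB.
apply: (scalerI c0); apply: (addIr ((p j * lam i) *: Aj + lam j *: Ai)).
have : indX (indY j (indY i u)) = x *: indX (indY i (indY j u)) + lij *: (indX u - indX (indI (a i * a j)%g u)).
  by rewrite IH linearD !linearZ linearB.
rewrite E1 E2 E3 => ->; rewrite [in RHS]scalerDr !scalerA.
by rewrite addrAC; congr (_ + _ + _); rewrite addrC.
Qed.

Lemma induced_rep : partial_rep r.+1 indI ind_gen.
Proof.
split; [exact: indI_one|exact: indI_mul|..].
- move=> g i v; rewrite ltnS leq_eqVlt /ind_gen; have [-> _|ir /= lt] := eqVneq i r.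
    exact: indX_conj.
  by apply: indY_conj; move: lt; rewrite (inj_eq val_inj) (negPf ir).
- move=> i v; rewrite ltnS leq_eqVlt /ind_gen; have [-> _|ir /= lt] := eqVneq i r.
    exact: indX_pow.
  by apply: indY_pow; move: lt; rewrite (inj_eq val_inj) (negPf ir).
move=> i j v ij; rewrite ltnS leq_eqVlt /ind_gen; have [ej _|jr /= lt] := eqVneq j r.
  rewrite ifN; last by rewrite neq_ltn -ej ij.
  by rewrite ej; apply: indX_indY; rewrite -ej.
have {}lt : (j < r)%N by move: lt; rewrite (inj_eq val_inj) (negPf jr).
by rewrite ifN ?neq_ltn ?(ltn_trans ij lt) //; apply: indY_link.
Qed.

End Step.

(* [ell] and [v0] witness that the elements of [G] act linearly independently. *)
Lemma exists_partial_rep (r : nat) : (r <= n)%N ->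
  exists (V : vectType F) (I : gT -> {linear V -> V}) (Y : 'I_n -> {linear V -> V})
    (v0 : V) (ell : gT -> {linear V -> F^o}),
    partial_rep r I Y /\ forall g h, ell g (I h v0) = (g == h)%:R.
Proof.
elim: r => [_|r IH rn].
  pose V : vectType F := {ffun gT -> F^o}.
  pose tr (g : gT) (v : V) : V := [ffun h => v (g^-1 * h)%g].
  have trl g : linear (tr g) by move=> c u v; apply/ffunP=> h; rewrite !ffunE.
  pose ev (g : gT) (v : V) : F^o := v g.
  have evl g : linear (ev g) by move=> c u v; rewrite /ev !ffunE.
  pose I g : {linear V -> V} := mk_linear (trl g).
  pose ell g : {linear V -> F^o} := mk_linear (evl g).
  exists V, I, (fun=> idfun), [ffun g => (g == 1%g)%:R], ell; split.
    split=> //.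
      by move=> v; apply/ffunP=> h; rewrite ffunE invg1 mul1g.
    by move=> g h v; apply/ffunP=> k; rewrite !ffunE invMg mulgA.
  move=> g h; rewrite /= /ev !ffunE.
  by rewrite -(inj_eq (mulgI h)) mulKVg mulg1.
have [V [I [Y [v0 [ell [rep ellE]]]]]] := IH (ltnW rn).
pose rr := Ordinal rn.
have N0 := dN_gt0 D rr.
pose V' : vectType F := {ffun 'I_(dN D rr) -> V}.
pose pr (v : V') : V := v (Ordinal N0).
have prl : linear pr by move=> c u v; rewrite /pr !ffunE.
pose prL : {linear V' -> V} := mk_linear prl.
exists V', (indI I rr), (ind_gen I Y rr), (single (dN D rr) 0 v0), (fun g => ell g \o prL); split.
  exact: (@induced_rep V I Y rr rep).
by move=> g h; rewrite indI_single // expr0 scale1r /= /pr ffunE ellE.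
Qed.

End PartialReps.

Section Endomorphisms.
Variables (F : fieldType) (V : vectType F).
Hypothesis V_proper : (0 < dim V)%N.

Definition end_algType : algType F :=
  let R := lfun_comp_nzRingType V_proper in
  let L : lalgType F :=
    HB.pack 'End(V) R (GRing.Lmodule_isLalgebra.Build F R (fun k x y => comp_lfunZl k x y)) in
  HB.pack 'End(V) L (GRing.Lalgebra_isAlgebra.Build F L (fun k x y => comp_lfunZr k x y)).

Lemma end_mulE (f g : end_algType) v : (f * g : 'End(V)) v = (f : 'End(V)) ((g : 'End(V)) v).
Proof. exact: comp_lfunE. Qed.

Lemma end_expE (f : end_algType) k v : (f ^+ k : 'End(V)) v = iter k (f : 'End(V)) v.
Proof.
elim: k v => [|k IH] v; first exact: id_lfunE.
by rewrite exprS end_mulE IH.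
Qed.
End Endomorphisms.

(** * Generation by monomials *)

Section Span.
Variables (F : fieldType) (V : lmodType F).
Implicit Type S : V -> Prop.

(** Intersection of all subspaces containing [S], so that a proof of membership is itself an
    induction principle. *)
Definition span_of S (y : V) : Prop :=
  forall P : V -> Prop, P 0 -> (forall c u v, P u -> P v -> P (c *: u + v)) ->
  (forall z, S z -> P z) -> P y.

Lemma span0 S : span_of S 0. Proof. by move=> P. Qed.

Lemma spanL S c u v : span_of S u -> span_of S v -> span_of S (c *: u + v).
Proof. by move=> Su Sv P P0 PL PS; exact: PL (Su P P0 PL PS) (Sv P P0 PL PS). Qed.

Lemma span_mem S y : S y -> span_of S y. Proof. by move=> Sy P P0 PL; apply. Qed.

Lemma spanZ S c u : span_of S u -> span_of S (c *: u).
Proof. by move=> Su; rewrite -[_ *: _]addr0; apply: spanL => //; apply: span0. Qed.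

Lemma spanD S u v : span_of S u -> span_of S v -> span_of S (u + v).
Proof. by move=> Su Sv; rewrite -[u]scale1r; apply: spanL. Qed.

Lemma span_sub S (P : V -> Prop) y : P 0 -> (forall c u v, P u -> P v -> P (c *: u + v)) ->
  (forall z, S z -> P z) -> span_of S y -> P y.
Proof. by move=> P0 PL PS Sy; apply: Sy. Qed.
End Span.

Section Presentation.
Variables (F : closedFieldType) (gT : finGroupType) (n : nat) (D : datum F gT n).
Hypothesis gT_abelian : abelian [set: gT].
Variables (H : algType F) (Hh : hopf H) (iota : gT -> H) (x : 'I_n -> H).
Hypothesis H_P : is_P D Hh iota x.

(** The functionals [ell] are pulled back along the map from [H] to the endomorphisms of [V] given
    by the universal property; [v0] also shows that [V] is nonzero. *)
Lemma iota_dual : exists phi : gT -> {linear H -> F^o},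
  forall g h, phi g (iota h) = (g == h)%:R.
Proof.
have [V [I [Y [v0 [ell [rep ellE]]]]]] := exists_partial_rep D gT_abelian (leqnn n).
have Vp : (0 < dim V)%N.
  rewrite lt0n; apply/eqP => d0.
  have v00 : I 1%g v0 = 0.
    apply: (@VectorInternalTheory.v2r_inj _ V); apply/rowP=> j.
    by have := ltn_ord j; rewrite {2}d0.
  by have := ellE 1%g 1%g; rewrite v00 linear0 eqxx => /esym/eqP; rewrite oner_eq0.
pose B := end_algType Vp.
have sub_lfunE (f g : 'End(V)) v : (f - g) v = f v - g v by rewrite add_lfunE opp_lfunE.
have rel : @P_relations F gT n D B (fun g => linfun (I g)) (fun i => linfun (Y i)).
  split.
  - by apply/lfunP=> v; rewrite lfunE /= (pr_one rep) id_lfunE.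
  - by move=> g h; apply/lfunP=> v; rewrite end_mulE !lfunE /= (pr_mul rep).
  - by move=> g i; apply/lfunP=> v; rewrite scale_lfunE !end_mulE !lfunE /= (pr_conj rep).
  - move=> i; apply/lfunP=> v; rewrite end_expE.
    rewrite (eq_iter (_ : _ =1 Y i)); last by move=> w; rewrite lfunE.
    by rewrite (pr_pow rep) // scale_lfunE /= sub_lfunE id_lfunE lfunE.
  - move=> i j ij; apply/lfunP=> v; rewrite add_lfunE !scale_lfunE !end_mulE.
    by rewrite /= sub_lfunE id_lfunE !lfunE /= (pr_link rep).
have [f [f_iota _ _]] := P_univ H_P rel.
pose phi g (h : H) : F^o := ell g ((f h : 'End(V)) v0).
have phil g : linear (phi g).
  by move=> c u v; rewrite /phi linearP add_lfunE scale_lfunE linearP.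
exists (fun g => mk_linear (phil g)).
by move=> g h; rewrite /= /phi f_iota lfunE ellE.
Qed.

Definition in_subalg (h : H) : Prop :=
  forall P : H -> Prop, P 1 -> (forall c u v, P u -> P v -> P (c *: u + v)) ->
  (forall u v, P u -> P v -> P (u * v)) ->
  (forall g, P (iota g)) -> (forall i, P (x i)) -> P h.

Definition subalg_pred : {pred H} := fun h => `[< in_subalg h >].

Fact subalg_pred_closed : subalg_closed subalg_pred.
Proof.
split=> [|c u v /asboolP Su /asboolP Sv|u v /asboolP Su /asboolP Sv]; apply/asboolP.
- by move=> P ? ? ? ? ?.
- by move=> P P1 PL PM Pg Px; exact: PL (Su P P1 PL PM Pg Px) (Sv P P1 PL PM Pg Px).
by move=> P P1 PL PM Pg Px; exact: PM (Su P P1 PL PM Pg Px) (Sv P P1 PL PM Pg Px).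
Qed.

HB.instance Definition _ :=
  GRing.isSubalgClosed.Build F H subalg_pred subalg_pred_closed.

Record subalg := SubAlg { subalg_val : H; _ : subalg_val \in subalg_pred }.
HB.instance Definition _ := [isSub for subalg_val].
HB.instance Definition _ := [Choice of subalg by <:].
HB.instance Definition _ := [SubChoice_isSubAlgebra of subalg by <:].

(** The universal property maps [H] into the subalgebra generated by [G] and the [x_i]. Followed by
    the inclusion, this map fixes the generators, hence is the identity by uniqueness. *)
Lemma P_generated h : in_subalg h.
Proof.
have Sg g : iota g \in subalg_pred by apply/asboolP=> P ? ? ? ? ?.
have Sx i : x i \in subalg_pred by apply/asboolP=> P ? ? ? ? ?.
pose B : algType F := subalg.
pose j : {rmorphism subalg -> H} := (val : subalg -> H).
have [r1 r2 r3 r4 r5] := P_rel H_P.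
have rel : @P_relations F gT n D B (fun g => SubAlg (Sg g)) (fun i => SubAlg (Sx i)).
  split.
  - exact: val_inj.
  - by move=> g k; apply: val_inj; rewrite /= r2.
  - by move=> g i; apply: val_inj; rewrite /= r3.
  - by move=> i; apply: val_inj; rewrite /= -[LHS]/(j _) rmorphXn /= r4.
  - by move=> i k ik; apply: val_inj; rewrite /= r5.
have [f [f_iota f_x _]] := P_univ H_P rel.
have [id_H [_ _ uniq]] := P_univ H_P (P_rel H_P).
pose jf (k : H) : H := val (f k).
have jf_lin : linear jf by move=> c u v; rewrite /jf linearP.
have jf_mul : monoid_morphism jf.
  by split=> [|u v]; [exact: (rmorph1 (j \o f))|exact: (rmorphM (j \o f))].
pose jF : {lrmorphism H -> H} := HB.pack jf (GRing.isLinear.Build F H H *:%R jf jf_lin)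
  (GRing.isMonoidMorphism.Build H H jf jf_mul).
have -> : h = val (f h).
  rewrite -[RHS]/(jF h) uniq => [|g|i]; rewrite /= /jf ?f_iota ?f_x //.
  by rewrite -(uniq idfun).
by apply/asboolP; case: (f h).
Qed.

Definition mon (w : seq 'I_n) (g : gT) : H := \prod_(i <- w) x i * iota g.

(* Strict bound: [filt 0] is zero and [filt 1] is the span of the group. *)
Definition filt (k : nat) : H -> Prop :=
  span_of (fun y => exists w g, (size w < k)%N /\ y = mon w g).

Lemma mon_nil g : mon [::] g = iota g.
Proof. by rewrite /mon big_nil mul1r. Qed.

Lemma mon_cons i w g : mon (i :: w) g = x i * mon w g.
Proof. by rewrite /mon big_cons mulrA. Qed.

Lemma iota_mon h w g : exists c, iota h * mon w g = c *: mon w (h * g)%g.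
Proof.
elim: w => [|i w [c IH]].
  by exists 1; rewrite !mon_nil scale1r (P_mul (P_rel H_P)).
exists (dchi D i h * c); rewrite !mon_cons mulrA (P_conj (P_rel H_P)) -scalerAl.
by rewrite -mulrA IH -scalerAr scalerA.
Qed.

Lemma mon_filt w g k : (size w < k)%N -> filt k (mon w g).
Proof. by move=> wk; apply: span_mem; exists w, g. Qed.

Lemma filt_mono k l h : (k <= l)%N -> filt k h -> filt l h.
Proof.
move=> kl; apply: span_sub => [||z [w [g [wk ->]]]]; [exact: span0|exact: spanL|].
by apply: mon_filt; apply: leq_trans kl.
Qed.

Lemma x_filt i k h : filt k h -> filt k.+1 (x i * h).
Proof.
move=> hk; apply: (hk (fun h => filt k.+1 (x i * h))).
- by rewrite mulr0; apply: span0.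
- by move=> c u v Pu Pv; rewrite mulrDr -scalerAr; apply: spanL.
by move=> z [w [g [wk ->]]]; rewrite -mon_cons; apply: mon_filt.
Qed.

Lemma iota_filt g k h : filt k h -> filt k (iota g * h).
Proof.
move=> hk; apply: (hk (fun h => filt k (iota g * h))).
- by rewrite mulr0; apply: span0.
- by move=> c u v Pu Pv; rewrite mulrDr -scalerAr; apply: spanL.
move=> z [w [h' [wk ->]]]; have [c ->] := iota_mon g w h'.
by apply: spanZ; apply: mon_filt.
Qed.

Lemma mon_span h : span_of (fun y => exists w g, y = mon w g) h.
Proof.
set S := fun y => _.
suff: forall y, span_of S y -> span_of S (h * y).
  move=> /(_ 1); rewrite mulr1; apply; apply: span_mem; exists [::], 1%g.
  by rewrite mon_nil (P_one (P_rel H_P)).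
apply: (P_generated h (P := fun h => forall y, span_of S y -> span_of S (h * y)))
  => [y|c u v Pu Pv y Sy|u v Pu Pv y Sy|g y Sy|i y Sy].
- by rewrite mul1r.
- by rewrite mulrDl -scalerAl; exact: spanL (Pu _ Sy) (Pv _ Sy).
- by rewrite -mulrA; exact: Pu (Pv _ Sy).
- apply: (Sy (fun y => span_of S (iota g * y))).
  + by rewrite mulr0; apply: span0.
  + by move=> c u v Pu Pv; rewrite mulrDr -scalerAr; apply: spanL.
  move=> z [w [h' ->]]; have [c ->] := iota_mon g w h'.
  by apply: spanZ; apply: span_mem; exists w, (g * h')%g.
apply: (Sy (fun y => span_of S (x i * y))).
+ by rewrite mulr0; apply: span0.
+ by move=> c u v Pu Pv; rewrite mulrDr -scalerAr; apply: spanL.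
by move=> z [w [h' ->]]; apply: span_mem; exists (i :: w), h'; rewrite mon_cons.
Qed.

(** Covers all orders of [i] and [j]: the linking relation, the same relation solved for the other
    product, and a trivial case with [d = 0]. Later arguments use only that the error term contains
    no [x]. *)
Lemma x_swap i j : exists c d g, x j * x i = c *: (x i * x j) + d *: (1 - iota g).
Proof.
have link := P_link (P_rel H_P).
have [ij|ji|/val_inj ->] := ltngtP i j.
- by exists (dchi D i (da D j)), (dlambda D i j), (da D i * da D j)%g; apply: link.
- exists (dchi D j (da D i))^-1, (- (dchi D j (da D i))^-1 * dlambda D j i), (da D j * da D i)%g.
  rewrite (link _ _ ji) scalerDr !scalerA mulVf ?char_neq0 // scale1r -addrA -scalerDl.
  by rewrite mulNr subrr scale0r addr0.
by exists 1, 0, 1%g; rewrite scale1r scale0r addr0.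
Qed.

(** Letters commute up to scalars modulo shorter words; the error consists of words of length at
    most [size (u ++ v)], one less than the word treated. *)
Lemma mon_front i u v g : exists c,
  filt (size (u ++ v)).+1 (mon (u ++ i :: v) g - c *: mon (i :: u ++ v) g).
Proof.
elim: u => [|j u [c IH]] /=.
  by exists 1; rewrite scale1r subrr; apply: span0.
have [c' [d [h e]]] := x_swap i j.
exists (c * c').
have -> : mon (j :: u ++ i :: v) g - (c * c') *: mon (i :: j :: u ++ v) g =
    x j * (mon (u ++ i :: v) g - c *: mon (i :: u ++ v) g)
    + (c * d) *: (mon (u ++ v) g - iota h * mon (u ++ v) g).
  rewrite !mon_cons mulrBr -addrA; congr (_ + _).
  have eM : x j * (x i * mon (u ++ v) g) = c' *: (x i * (x j * mon (u ++ v) g))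
      + d *: (mon (u ++ v) g - iota h * mon (u ++ v) g).
    by rewrite mulrA e mulrDl -!scalerAl mulrBl mul1r mulrA.
  by rewrite -scalerAr eM scalerDr !scalerA opprD -addrA addNr addr0.
apply: spanD; first exact: x_filt.
apply: spanZ; apply: spanD.
  by apply: mon_filt.
rewrite -scaleN1r; apply: spanZ; apply: (@filt_mono (size (u ++ v)).+1) => //.
by apply: iota_filt; apply: mon_filt.
Qed.

Lemma mon_collect i t w g : (t <= count_mem i w)%N -> exists c w',
  (t + size w' = size w)%N /\
  filt (size w) (mon w g - c *: mon (nseq t i ++ w') g).
Proof.
elim: t w => [|t IH] w tw.
  by exists 1, w; split=> //; rewrite scale1r subrr; apply: span0.
have: i \in w by rewrite -has_pred1 has_count (leq_ltn_trans _ tw).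
move=> /splitPr ew; case: ew tw => u v.
rewrite count_cat /= eqxx addnCA add1n ltnS -count_cat => tw.
have [c [w' [sw' Ew]]] := IH _ tw.
have [c1 E1] := mon_front i u v g.
have su : size (u ++ i :: v) = (size (u ++ v)).+1 by rewrite !size_cat addnS.
exists (c1 * c), w'; split; first by rewrite addSn sw' su.
rewrite su /=.
have -> : mon (u ++ i :: v) g - (c1 * c) *: mon (i :: nseq t i ++ w') g =
    (mon (u ++ i :: v) g - c1 *: mon (i :: u ++ v) g)
    + c1 *: (x i * (mon (u ++ v) g - c *: mon (nseq t i ++ w') g)).
  rewrite !mon_cons mulrBr scalerBr -scalerAr scalerA addrA addrNK //.
by apply: spanD => //; apply: spanZ; apply: x_filt.
Qed.

(* A long word contains some [x_i] at least [N_i] times; these can be collected in front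
   modulo shorter words, and [x_i ^ N_i] lies in the group algebra. *)
Lemma mon_reduce w g : (\sum_i dN D i < size w)%N -> filt (size w) (mon w g).
Proof.
move=> Kw.
have [i iw] : exists i, (dN D i <= count_mem i w)%N.
  apply: NNPP => h; move: Kw; rewrite ltnNge => /negP; apply.
  have -> : size w = (\sum_i count_mem i w)%N.
    elim: w {h} => [|i w IH] /=; first by rewrite big1.
    by rewrite big_split /= -IH (bigD1 i) //= ?eqxx big1 ?addn0 // => j /negPf ji; rewrite eq_sym ji.
  apply: leq_sum => i _; rewrite leqNgt; apply/negP => lt.
  by apply: h; exists i; apply: ltnW.
have [c [w' [sw E]]] := mon_collect g iw.
rewrite -[mon w g](subrK (c *: mon (nseq (dN D i) i ++ w') g)).
apply: spanD => //; apply: spanZ.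
have -> : mon (nseq (dN D i) i ++ w') g = x i ^+ dN D i * mon w' g.
  rewrite /mon big_cat /= mulrA; congr (_ * _ * _).
  by elim: (dN D i) => [|t IH] /=; rewrite ?big_nil ?expr0 // big_cons IH exprS.
have w'w : (size w' < size w)%N by rewrite -sw -[X in (X < _)%N]add0n ltn_add2r dN_gt0.
rewrite (P_power (P_rel H_P)) -scalerAl mulrBl mul1r; apply: spanZ.
apply: spanD; first exact: mon_filt.
by rewrite -scaleN1r; apply: spanZ; apply: iota_filt; apply: mon_filt.
Qed.

(** The successor compensates for the strict bound in [filt]. *)
Definition word_bound := (\sum_i dN D i).+1.

Lemma filt_bound h : filt word_bound h.
Proof.
suff key k h' : filt k h' -> filt word_bound h'.
  apply: (mon_span h) => [|c u v|z [w [g ->]]]; [exact: span0|exact: spanL|].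
  exact: (key (size w).+1 _ (mon_filt _ _)).
elim: k h' => [|k IH] h'.
  by apply: filt_mono.
move=> hk; apply: hk => [|c u v|z [w [g [wk ->]]]]; [exact: span0|exact: spanL|].
have [wb|wb] := ltnP (size w) word_bound; first exact: mon_filt.
by apply: IH; apply: (@filt_mono (size w)) => //; apply: mon_reduce.
Qed.

End Presentation.

(** * Extending linear maps along monomials *)

Section Functional.
Variables (F : fieldType) (V : lmodType F).

Definition subspace (E : V -> Prop) := E 0 /\ forall c u v, E u -> E v -> E (c *: u + v).

Lemma subspaceZ E c u : subspace E -> E u -> E (c *: u).
Proof. by case=> E0 EL Eu; rewrite -[_ *: _]addr0; apply: EL. Qed.

Definition add_line (E : V -> Prop) (M y : V) := exists c, E (y - c *: M).

Lemma add_line_sub (E : V -> Prop) M y : E y -> add_line E M y.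
Proof. by exists 0; rewrite scale0r subr0. Qed.

Lemma add_line_mem (E : V -> Prop) M : subspace E -> add_line E M M.
Proof. by case=> E0 _; exists 1; rewrite scale1r subrr. Qed.

Lemma add_line_subspace (E : V -> Prop) M : subspace E -> subspace (add_line E M).
Proof.
move=> [E0 EL]; split; first exact: add_line_sub.
move=> c u v [cu Eu] [cv Ev]; exists (c * cu + cv).
have -> : c *: u + v - (c * cu + cv) *: M = c *: (u - cu *: M) + (v - cv *: M).
  by rewrite scalerBr scalerA addrACA -opprD -scalerDl.
exact: EL.
Qed.

(** Each [l] of the list is adjoined to [E'] unless that would capture [M]; in that case [l] already
    lies in [E' + F M]. *)
Lemma hyperplane (E : V -> Prop) M (L : seq V) : subspace E -> ~ E M ->
  exists E' : V -> Prop, [/\ subspace E', forall y, E y -> E' y, ~ E' M &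
    forall l, l \in L -> add_line E' M l].
Proof.
move=> sE EM; elim: L => [|l L [E' [sE' EE' E'M E'L]]]; first by exists E.
have [lM|lM] := classic (add_line E' l M).
  exists E'; split=> // y; rewrite inE => /predU1P[->{y}|]; last exact: E'L.
  have [c Ec] := lM.
  have c0 : c != 0 by apply/eqP=> c0; apply: E'M; move: Ec; rewrite c0 scale0r subr0.
  exists c^-1.
  have -> : l - c^-1 *: M = (- c^-1) *: (M - c *: l).
    by rewrite scalerBr !scaleNr scalerA mulVf // scale1r opprK addrC.
  exact: subspaceZ.
exists (add_line E' l); split=> //; first exact: add_line_subspace.
  by move=> y Ey; apply: add_line_sub; apply: EE'.
move=> y; rewrite inE => /predU1P[->|yL].
  by apply: add_line_sub; apply: add_line_mem.
have [c Ec] := E'L _ yL.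
by exists c; apply: add_line_sub.
Qed.

Lemma separating_functional (E : V -> Prop) M (L : seq V) :
  (forall y, span_of (fun z => z \in L) y) -> subspace E -> ~ E M ->
  exists phi : {linear V -> F^o}, (forall y, E y -> phi y = 0) /\ phi M = 1.
Proof.
move=> spL sE EM; have [E' [sE' EE' E'M E'L]] := hyperplane L sE EM.
have all_ext y : add_line E' M y.
  have [e0 eL] := add_line_subspace M sE'.
  exact: (span_sub e0 eL E'L (spL y)).
have uniq y c d : E' (y - c *: M) -> E' (y - d *: M) -> c = d.
  move=> Ec Ed; apply/eqP; rewrite -subr_eq0; apply/negP/negP; apply: contra_notT E'M => cd.
  have e : (-1) *: (y - c *: M) + (y - d *: M) = (c - d) *: M.
    by rewrite scaleN1r opprB addrA subrK -scalerBl.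
  have -> : M = (c - d)^-1 *: ((-1) *: (y - c *: M) + (y - d *: M)).
    by rewrite e scalerA mulVf // scale1r.
  by apply: subspaceZ => //; case: sE' => _; apply.
(* The functional reads off the coefficient of [M] in the decomposition of [V] as the direct sum of
   [E'] and [F M]. *)
pose phi (y : V) : F^o := projT1 (cid (all_ext y)).
have phiP y : E' (y - phi y *: M) by rewrite /phi; case: cid.
have phil : linear phi.
  move=> c u v; apply: (uniq (c *: u + v)) => //.
  have -> : c *: u + v - (c *: phi u + phi v) *: M =
      c *: (u - phi u *: M) + (v - phi v *: M).
    by rewrite scalerBr scalerA addrACA -opprD -scalerDl.
  by case: sE' => _; apply.
exists (mk_linear phil); split=> [y Ey|] /=.
  by apply: (uniq y) => //; rewrite scale0r subr0; apply: EE'.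
by apply: (uniq M) => //; rewrite scale1r subrr; case: sE'.
Qed.
End Functional.

(** * Tensors represented by lists, and subcoalgebras *)

Definition bilinear (F : fieldType) (U V W : lmodType F) (f : U -> V -> W) :=
  (forall v, linear (f^~ v)) /\ (forall u, linear (f u)).

Section Tensors.
Variables (F : fieldType) (U V : lmodType F).

Lemma tensor_sum (W : lmodType F) (f : U -> V -> W) s t : bilinear f -> tensor_eq s t ->
  \sum_(p <- s) f p.1 p.2 = \sum_(p <- t) f p.1 p.2.
Proof. by move=> [f1 f2]; apply. Qed.

Lemma tensor_scale c (s t : seq (U * V)) : tensor_eq s t ->
  tensor_eq [seq (c *: p.1, p.2) | p <- s] [seq (c *: p.1, p.2) | p <- t].
Proof.
move=> st W f f1 f2; rewrite !big_map /=.
apply: (st W (fun u v => f (c *: u) v)) => // v a u w.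
by rewrite scalerDr scalerA mulrC -scalerA f1.
Qed.

Lemma tensor_cat (s t s' t' : seq (U * V)) : tensor_eq s t -> tensor_eq s' t' ->
  tensor_eq (s ++ s') (t ++ t').
Proof.
by move=> st st' W f f1 f2; rewrite !big_cat (st _ _ f1 f2) (st' _ _ f1 f2).
Qed.

Lemma tensor_trans (s t r : seq (U * V)) : tensor_eq s t -> tensor_eq t r -> tensor_eq s r.
Proof. by move=> st tr W f f1 f2; rewrite (st _ _ f1 f2) (tr _ _ f1 f2). Qed.

End Tensors.

Section Coalgebra.
Variables (F : fieldType) (H : algType F) (Hh : hopf H).

Lemma comul_sum_linear (W : lmodType F) (f : H -> H -> W) : bilinear f ->
  linear (fun h => \sum_(p <- comul Hh h) f p.1 p.2).
Proof.
move=> bf c h k; rewrite (tensor_sum bf (comul_linear _ _ _ _)) big_cat big_map /=.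
congr (_ + _); rewrite scaler_sumr; apply: eq_bigr => p _.
have := bf.1 p.2 c p.1 0; rewrite addr0 => ->.
by have := bf.1 p.2 (-1) p.1 p.1; rewrite scaleN1r addNr scaleN1r addNr => ->; rewrite addr0.
Qed.

(** The list [comul h] matters only up to [tensor_eq], so its own entries may lie outside [E]; some
    list representing the same tensor must have its entries in [E]. *)
Definition subcoalg (E : H -> Prop) := subspace E /\ forall h, E h ->
  exists t, (forall p, p \in t -> E p.1 /\ E p.2) /\ tensor_eq (comul Hh h) t.

Lemma add_line_subcoalg (E : H -> Prop) M g g' (t : seq (H * H)) : subcoalg E -> E g -> E g' ->
  (forall p, p \in t -> E p.1 /\ E p.2) ->
  tensor_eq (comul Hh M) ((M, g) :: (g', M) :: t) -> subcoalg (add_line E M).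
Proof.
move=> [sE cE] Eg Eg' Et MT; split; first exact: add_line_subspace.
have sE' := add_line_subspace M sE.
move=> h [c Eh]; have [s [Es hs]] := cE _ Eh.
exists ([seq (c *: p.1, p.2) | p <- (M, g) :: (g', M) :: t] ++ s); split.
  move=> p; rewrite mem_cat => /orP[/mapP[r rT ->]|ps]; last first.
    by have [? ?] := Es _ ps; split; apply: add_line_sub.
  have [r1 r2] : add_line E M r.1 /\ add_line E M r.2.
    move: rT; rewrite !inE => /or3P[/eqP->|/eqP->|rt] /=.
    - by split; [apply: add_line_mem|apply: add_line_sub].
    - by split; [apply: add_line_sub|apply: add_line_mem].
    by have [? ?] := Et _ rt; split; apply: add_line_sub.
  by split=> //=; apply: subspaceZ.
have -> : h = c *: M + (h - c *: M) by rewrite addrC subrK.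
apply: tensor_trans (comul_linear _ _ _ _) _.
by apply: tensor_cat => //; apply: tensor_scale.
Qed.

Section Extension.
Variables (A : lmodType F) (cond : {linear H -> A} -> H -> Prop) (E0 : H -> Prop).
Hypothesis H_fin : exists L : seq H, forall y, span_of (fun z => z \in L) y.
Hypothesis cond_subspace : forall u, subspace (cond u).
Hypothesis cond_local : forall (E : H -> Prop) (u u' : {linear H -> A}),
  subcoalg E -> (forall h, E0 h -> E h) -> (forall h, E h -> u' h = u h) ->
  forall h, E h -> cond u h -> cond u' h.
Hypothesis cond_step : forall (E : H -> Prop) (u : {linear H -> A}) M g g' (t : seq (H * H)),
  subcoalg E -> (forall h, E0 h -> E h) -> (forall h, E h -> cond u h) ->
  (forall p, p \in t -> E p.1 /\ E p.2) ->
  tensor_eq (comul Hh M) ((M, g) :: (g', M) :: t) -> E0 g -> E0 g' ->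
  exists c, forall u' : {linear H -> A},
    (forall h, E h -> u' h = u h) -> u' M = c -> cond u' M.

(** Here [cond u h] is the equation to be solved at [h]: it is linear in [h] and, on a subcoalgebra,
    depends only on the values of [u] there. [E0] stands for the group-likes, which every [E]
    contains. *)
Definition solves_on (E : H -> Prop) (u : {linear H -> A}) :=
  [/\ subcoalg E, forall h, E0 h -> E h & forall h, E h -> cond u h].

(** A functional that is 0 on [E] and 1 at [M] corrects the value of [u] at [M] to [c] and leaves
    [u] unchanged on [E]. The value is an argument so that it can be prescribed at [x]. *)
Lemma solves_on_extend_with (E : H -> Prop) (u : {linear H -> A}) M g g' (t : seq (H * H)) c :
  solves_on E u -> ~ E M -> (forall p, p \in t -> E p.1 /\ E p.2) ->
  tensor_eq (comul Hh M) ((M, g) :: (g', M) :: t) -> E0 g -> E0 g' ->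
  (forall u' : {linear H -> A}, (forall h, E h -> u' h = u h) -> u' M = c -> cond u' M) ->
  exists u' : {linear H -> A}, [/\ solves_on (add_line E M) u', u' M = c &
    forall h, E h -> u' h = u h].
Proof.
move=> [cE EE0 Eu] EM Et MT E0g E0g' cP.
have [L spL] := H_fin.
have [phi [phiE phiM]] := separating_functional spL cE.1 EM.
pose w (h : H) : A := u h + phi h *: (c - u M).
have wl : linear w.
  move=> a h k; rewrite /w; move: (c - u M) => X.
  by rewrite !linearP scalerDl scalerDr -scalerA addrACA.
pose u' := mk_linear wl.
have u'E h : E h -> u' h = u h by move=> Eh; rewrite /= /w phiE // scale0r addr0.
have u'M : u' M = c by rewrite /= /w phiM scale1r addrC subrK.
exists u'; split=> //; split.
- by apply: add_line_subcoalg MT => //; apply: EE0.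
- by move=> h E0h; apply: add_line_sub; apply: EE0.
move=> h [d Eh].
have -> : h = d *: M + (h - d *: M) by rewrite addrC subrK.
apply: (cond_subspace u').2; first exact: cP.
by apply: (cond_local cE EE0 u'E) => //; apply: Eu.
Qed.

Lemma solves_on_extend (E : H -> Prop) (u : {linear H -> A}) M g g' (t : seq (H * H)) :
  solves_on E u -> (forall p, p \in t -> E p.1 /\ E p.2) ->
  tensor_eq (comul Hh M) ((M, g) :: (g', M) :: t) -> E0 g -> E0 g' ->
  exists (E' : H -> Prop) (u' : {linear H -> A}), [/\ solves_on E' u', E' M,
    forall h, E h -> E' h & forall h, E h -> u' h = u h].
Proof.
move=> gu Et MT E0g E0g'; have [cE EE0 Eu] := gu.
have [EM|EM] := classic (E M); first by exists E, u.
have [c cP] := cond_step cE EE0 Eu Et MT E0g E0g'.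
have [u' [gu' _ u'E]] := solves_on_extend_with gu EM Et MT E0g E0g' cP.
exists (add_line E M), u'; split=> //; first exact: (add_line_mem _ cE.1).
by move=> h; apply: add_line_sub.
Qed.

End Extension.
End Coalgebra.

Section TensorProducts.
Variables (F : fieldType) (H : algType F).

Lemma tensor_perm (U V : lmodType F) (s t : seq (U * V)) : perm_eq s t -> tensor_eq s t.
Proof. by move=> st W f f1 f2; apply: perm_big. Qed.

Lemma bilinear_mul (W : lmodType F) (f : H -> H -> W) a b : bilinear f ->
  bilinear (fun u v => f (a * u) (b * v)).
Proof.
move=> [f1 f2]; split=> [v c u w|u c v w]; first by rewrite mulrDr -scalerAr f1.
by rewrite mulrDr -scalerAr f2.
Qed.

Lemma tensor_mul (s s' t t' : seq (H * H)) : tensor_eq s s' -> tensor_eq t t' ->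
  tensor_eq [seq (p.1 * q.1, p.2 * q.2) | p <- s, q <- t]
    [seq (p.1 * q.1, p.2 * q.2) | p <- s', q <- t'].
Proof.
move=> ss' tt' W f f1 f2; rewrite !big_allpairs_dep /=.
transitivity (\sum_(p <- s) \sum_(q <- t') f (p.1 * q.1) (p.2 * q.2)).
  apply: eq_bigr => p _.
  by apply: (tensor_sum (bilinear_mul p.1 p.2 (conj f1 f2)) tt').
apply: (ss' W (fun u v => \sum_(q <- t') f (u * q.1) (v * q.2))) => [v c u w|u c v w].
  rewrite scaler_sumr -big_split; apply: eq_bigr => q _.
  by rewrite mulrDl -scalerAl f1.
rewrite scaler_sumr -big_split; apply: eq_bigr => q _.
by rewrite mulrDl -scalerAl f2.
Qed.
End TensorProducts.

(** * Coproducts of monomials and extension to all of [H] *)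

Section Monomials.
Variables (F : closedFieldType) (gT : finGroupType) (n : nat) (D : datum F gT n).
Variables (H : algType F) (Hh : hopf H) (iota : gT -> H) (x : 'I_n -> H).
Hypothesis H_P : is_P D Hh iota x.
Local Notation mon := (mon iota x).
Local Notation filt := (filt iota x).

(** Expanding the product of the [x_i (x) 1 + a_i (x) x_i], the two displayed terms choose the same
    summand throughout; every other term splits the letters, so both its factors are shorter
    words. *)
Lemma comul_mon i w g : exists h (t : seq (H * H)),
  (forall p, p \in t -> filt (size w).+1 p.1 /\ filt (size w).+1 p.2) /\
  tensor_eq (comul Hh (mon (i :: w) g))
    ((mon (i :: w) g, iota g) :: (iota h, mon (i :: w) g) :: t).
Proof.
have iM := P_mul (P_rel H_P).
elim: w i => [|j w IH] i.
  exists (da D i * g)%g, [::]; split=> //.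
  rewrite mon_cons mon_nil; apply: tensor_trans (comulM Hh _ _) _.
  apply: tensor_trans (tensor_mul (P_comul_x H_P i) (P_comul_g H_P g)) _.
  by rewrite /= mul1r iM; move=> W f.
have [h [t [Et wt]]] := IH j.
set w' := j :: w in IH wt *.
set m := mon w' g in wt *.
pose t' := (x i * iota h, m) :: (iota (da D i) * m, x i * iota g) ::
  [seq (x i * p.1, p.2) | p <- t] ++ [seq (iota (da D i) * p.1, x i * p.2) | p <- t].
have mE : mon (i :: w') g = x i * m by rewrite mon_cons.
have tE : perm_eq [seq (p.1 * q.1, p.2 * q.2) |
      p <- [:: (x i, 1); (iota (da D i), x i)], q <- (m, iota g) :: (iota h, m) :: t]
    ((mon (i :: w') g, iota g) :: (iota (da D i * h)%g, mon (i :: w') g) :: t').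
  rewrite !mE /allpairs_dep /= cats0 !mul1r -iM perm_cons perm_sym.
  set y1 := (_, x i * m); set y2 := (_, m); set y3 := (_, x i * iota g).
  under eq_map => p do rewrite mul1r.
  set s1 := map _ t; set s2 := map _ t.
  by apply/seq.permP=> b; rewrite /t' -/y2 -/y3 /= !count_cat /= -/s1 -/s2; ring.
exists (da D i * h)%g, t'; split; last first.
  rewrite {1}mon_cons; apply: tensor_trans (comulM Hh _ _) _.
  apply: tensor_trans (tensor_mul (P_comul_x H_P i) wt) _.
  exact: tensor_perm.
have f1 y g' : filt (size w').+1 (x y * iota g').
  by rewrite -(mon_nil iota x) -mon_cons; apply: mon_filt.
have fm : filt (size w').+1 m by apply: mon_filt.
move=> p; rewrite !inE mem_cat => /or3P[/eqP->|/eqP->|/orP[|]] /=.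
- by split.
- by split; [apply: (iota_filt H_P)|].
- move=> /mapP[q qt ->] /=; have [q1 q2] := Et _ qt.
  by split; [apply: x_filt|apply: filt_mono q2].
move=> /mapP[q qt ->] /=; have [q1 q2] := Et _ qt.
split; last exact: x_filt.
by apply: (iota_filt H_P); apply: filt_mono q1.
Qed.

Definition words k : seq (seq 'I_n * gT) :=
  [seq (val (w : k.-tuple 'I_n), g) | w <- enum {:k.-tuple 'I_n}, g <- enum gT].

Lemma mem_words (w : seq 'I_n) (g : gT) : (w, g) \in words (size w).
Proof.
have -> : (w, g) = (val (in_tuple w), g) by [].
by apply: allpairs_f; rewrite mem_enum.
Qed.

Lemma words_size k p : p \in words k -> size p.1 = k.
Proof. by move=> /allpairsP[[w g] [_ _ ->]] /=; rewrite size_tuple. Qed.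

Lemma P_finite : exists L : seq H, forall y, span_of (fun z => z \in L) y.
Proof.
exists (flatten (mkseq (fun k => [seq mon p.1 p.2 | p <- words k]) (word_bound D))) => y.
apply: (span_sub _ _ _ (filt_bound H_P y)) => [|c u v|z [w [g [wb ->]]]].
- exact: span0.
- exact: spanL.
apply: span_mem; apply/flatten_mapP; exists (size w); first by rewrite mem_iota.
by apply/mapP; exists (w, g); rewrite ?mem_words.
Qed.

Section Extension.
Variables (A : lmodType F) (cond : {linear H -> A} -> H -> Prop) (E0 : H -> Prop).
Hypothesis E0_iota : forall g, E0 (iota g).
Hypothesis cond_subspace : forall u, subspace (cond u).
Hypothesis cond_local : forall (E : H -> Prop) (u u' : {linear H -> A}),
  subcoalg Hh E -> (forall h, E0 h -> E h) -> (forall h, E h -> u' h = u h) ->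
  forall h, E h -> cond u h -> cond u' h.
Hypothesis cond_step : forall (E : H -> Prop) (u : {linear H -> A}) M g g' (t : seq (H * H)),
  subcoalg Hh E -> (forall h, E0 h -> E h) -> (forall h, E h -> cond u h) ->
  (forall p, p \in t -> E p.1 /\ E p.2) ->
  tensor_eq (comul Hh M) ((M, g) :: (g', M) :: t) -> E0 g -> E0 g' ->
  exists c, forall u' : {linear H -> A},
    (forall h, E h -> u' h = u h) -> u' M = c -> cond u' M.

Lemma extend_all (E : H -> Prop) (u : {linear H -> A}) : solves_on Hh cond E0 E u ->
  exists u' : {linear H -> A}, (forall h, cond u' h) /\ forall h, E h -> u' h = u h.
Proof.
move=> gu.
suff key k : exists (E' : H -> Prop) (u' : {linear H -> A}), [/\ solves_on Hh cond E0 E' u',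
    forall h, filt k h -> E' h, forall h, E h -> E' h & forall h, E h -> u' h = u h].
  have [E' [u' [[cE' _ Eu'] fE' _ u'E]]] := key (word_bound D).
  by exists u'; split=> // h; apply: Eu'; apply: fE'; apply: (filt_bound H_P).
elim: k => [|k [E1 [u1 [gu1 fE1 EE1 u1E]]]].
  exists E, u; split=> // h; have [[[e0 eL] _] _ _] := gu.
  by apply: span_sub => // z [w [g []]].
(* The monomials of length [k] are adjoined one by one; the middle terms of their coproducts lie in
   [filt k], hence already in [E1]. *)
suff inner (l : seq (seq 'I_n * gT)) : (forall p, p \in l -> size p.1 = k) ->
  exists (E' : H -> Prop) (u' : {linear H -> A}), [/\ solves_on Hh cond E0 E' u',
    forall p, p \in l -> E' (mon p.1 p.2),
    forall h, E1 h -> E' h & forall h, E1 h -> u' h = u1 h].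
  have [E' [u' [gu' lE' E1E' u'E]]] := inner _ (@words_size k).
  exists E', u'; split=> //.
  - move=> h; have [[[e0 eL] _] _ _] := gu'.
    apply: span_sub => // z [w [g [wk ->]]].
    move: wk; rewrite ltnS leq_eqVlt => /predU1P[wk|wk].
      by apply: (lE' (w, g)); rewrite -wk mem_words.
    by apply: E1E'; apply: fE1; apply: mon_filt.
  - by move=> h Eh; apply: E1E'; apply: EE1.
  by move=> h Eh; rewrite u'E ?u1E //; apply: EE1.
elim: l => [_|[w g] l IH lk]; first by exists E1, u1.
have [|E2 [u2 [gu2 lE2 E12 u2E]]] := IH; first by move=> p pl; apply: lk; rewrite inE pl orbT.
have wk : size w = k := lk _ (mem_head _ _).
case: w wk {lk IH} => [|i w] wk.
  exists E2, u2; split=> // p; rewrite inE => /predU1P[->|]; last exact: lE2.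
  by rewrite mon_nil; have [_ + _] := gu2; apply.
have [h [t [Et Mt]]] := comul_mon i w g.
have Et2 p : p \in t -> E2 p.1 /\ E2 p.2.
  by move=> pt; have [? ?] := Et _ pt; split; apply: E12; apply: fE1; rewrite -wk.
have [E3 [u3 [gu3 E3M E23 u3E]]] :=
  solves_on_extend P_finite cond_subspace cond_local cond_step gu2 Et2 Mt (E0_iota _) (E0_iota _).
exists E3, u3; split=> //.
- by move=> p; rewrite inE => /predU1P[->//|/lE2/E23].
- by move=> y /E12/E23.
by move=> y Ey; rewrite u3E ?u2E //; apply: E12.
Qed.

End Extension.

End Monomials.

(** * Existence of the inner action *)

Section SkewDerivation.
Variables (F : fieldType) (m : nat).
Local Notation A := 'M[F]_m.+1.

(** With [y] the sum of [d(e_i0) e_0i], evaluate the sum of [d(b e_i0) e_0i] twice: the Leibniz rule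
    gives [d b + b y], and expanding [b e_i0] in matrix units gives [y b]. *)
Lemma derivation_inner (d : A -> A) : linear d ->
  (forall b c, d (b * c) = d b * c + b * d c) ->
  exists y, forall b, d b = y * b - b * y.
Proof.
move=> dl dM; pose dL := mk_linear dl.
pose e (i j : 'I_m.+1) : A := delta_mx i j.
exists (\sum_i d (e i 0) * e 0 i) => b.
have bE i : b * e i 0 = \sum_j b j i *: e j 0.
  rewrite {1}[b]matrix_sum_delta mulr_suml; apply: eq_bigr => j _.
  rewrite mulr_suml (bigD1 i) //= big1 ?addr0 => [|l li].
    by rewrite -scalerAl -[_ * _]/(_ *m _) mul_delta_mx.
  by rewrite -scalerAl -[_ * _]/(_ *m _) mul_delta_mx_0 ?scaler0.
have eb j : e 0 j * b = \sum_i b j i *: e 0 i.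
  rewrite {1}[b]matrix_sum_delta mulr_sumr (bigD1 j) //= [X in _ + X]big1 ?addr0 => [|l lj].
    rewrite mulr_sumr; apply: eq_bigr => i _.
    by rewrite -scalerAr -[_ * _]/(_ *m _) mul_delta_mx.
  rewrite mulr_sumr big1 // => i _.
  by rewrite -scalerAr -[_ * _]/(_ *m _) mul_delta_mx_0 ?scaler0 // eq_sym.
have one : \sum_i e i 0 * e 0 i = 1.
  rewrite [RHS]mx1_sum_delta; apply: eq_bigr => i _.
  by rewrite -[_ * _]/(_ *m _) mul_delta_mx.
have -> : b * (\sum_i d (e i 0) * e 0 i) = (\sum_i d (b * e i 0) * e 0 i) - d b.
  apply/eqP; rewrite eq_sym subr_eq; apply/eqP.
  rewrite -[d b in RHS]mulr1 -one !mulr_sumr -big_split; apply: eq_bigr => i _ /=.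
  by rewrite dM mulrDl !mulrA addrC.
rewrite opprB [RHS]addrC -addrA -{1}[d b]addr0; congr (_ + _); apply/esym/eqP.
rewrite addrC subr_eq0; apply/eqP.
under [RHS]eq_bigr => i _.
  rewrite bE -[d _]/(dL _) linear_sum mulr_suml /=.
  over.
rewrite exchange_big mulr_suml; apply: eq_bigr => j _ /=.
rewrite -mulrA eb mulr_sumr; apply: eq_bigr => i _.
by rewrite -[d (b j i *: _)]/(dL _) linearZ /= -scalerAl -scalerAr.
Qed.

(** As [U^-1 al(b) = b U^-1], the map [U^-1 d] is an ordinary derivation; if it is inner by [y],
    then [C = U y]. *)
Lemma skew_derivation_inner (d al : A -> A) (U : A) : linear d -> U \is a GRing.unit ->
  (forall b, U * b = al b * U) ->
  (forall b c, d (b * c) = d b * c + al b * d c) ->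
  exists C, forall b, C * b = d b + al b * C.
Proof.
move=> dl Uu alE dM.
have alE' b : U^-1 * al b = b * U^-1.
  by apply: (mulrI Uu); rewrite mulrA divrr // mul1r mulrA alE mulrK.
have [||y yE] := @derivation_inner (fun b => U^-1 * d b).
- by move=> c u v; rewrite dl mulrDr -scalerAr.
- by move=> b c; rewrite dM mulrDr !mulrA alE'.
exists (U * y) => b.
have -> : d b = U * (y * b - b * y) by rewrite -yE mulrA divrr // mul1r.
by rewrite mulrBr !mulrA (alE b) subrK.
Qed.
End SkewDerivation.

Section Inner.
Variables (F : closedFieldType) (gT : finGroupType) (n : nat) (D : datum F gT n).
Hypothesis gT_abelian : abelian [set: gT].
Variables (H : algType F) (Hh : hopf H) (iota : gT -> H) (x : 'I_n -> H).
Hypothesis H_P : is_P D Hh iota x.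

Definition is_iota (h : H) := exists g, h = iota g.

Lemma span_subspace (V : lmodType F) (S : V -> Prop) : subspace (span_of S).
Proof. by split; [exact: span0|exact: spanL]. Qed.

Lemma comul0 : tensor_eq (comul Hh 0) [::].
Proof.
move=> W f f1 f2; rewrite big_nil.
have fl := comul_sum_linear Hh (conj f1 f2).
by have := fl (-1) 0 0; rewrite scaler0 addr0 scaleN1r addNr.
Qed.

Lemma span_iota_subcoalg : subcoalg Hh (span_of is_iota).
Proof.
split; first exact: span_subspace.
move=> h hS; apply: (hS (fun h => exists t : seq (H * H), (forall p, p \in t ->
  span_of is_iota p.1 /\ span_of is_iota p.2) /\ tensor_eq (comul Hh h) t))
  => [|c u v [s [sE us]] [t [tE vt]]|z [g ->]].
- by exists [::]; split=> //; apply: comul0.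
- exists ([seq (c *: p.1, p.2) | p <- s] ++ t); split; last first.
    apply: tensor_trans (comul_linear _ _ _ _) _.
    by apply: tensor_cat => //; apply: tensor_scale.
  move=> p; rewrite mem_cat => /orP[/mapP[r rs ->]|/tE//] /=.
  by have [? ?] := sE _ rs; split=> //; apply: spanZ.
exists [:: (iota g, iota g)]; split; last exact: P_comul_g H_P g.
by move=> p; rewrite inE => /eqP -> /=; split; apply: span_mem; exists g.
Qed.

Lemma iota_map (A : lmodType F) (r : gT -> A) :
  exists u : {linear H -> A}, forall g, u (iota g) = r g.
Proof.
have [phi phiE] := iota_dual gT_abelian H_P.
pose u h := \sum_g phi g h *: r g.
have ul : linear u.
  move=> c h k; rewrite /u scaler_sumr -big_split; apply: eq_bigr => g _.
  by rewrite linearP scalerDl scalerA.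
exists (mk_linear ul) => g; rewrite /= /u (bigD1 g) //= phiE eqxx scale1r.
by rewrite big1 ?addr0 // => h hg; rewrite phiE (negPf hg) scale0r.
Qed.

(** An element of the group algebra commutes with [a_i], whereas [a_i x_i = q_i x_i a_i] with [q_i]
    different from 1. So either [u] can be prescribed at [x_i] or [x_i] is zero. *)
Lemma x_span_iota i : span_of is_iota (x i) -> x i = 0.
Proof.
move=> xS; set a := da D i.
have comm : iota a * x i = x i * iota a.
  apply: (xS (fun h => iota a * h = h * iota a)) => [|c u v eu ev|z [g ->]].
  - by rewrite mulr0 mul0r.
  - by rewrite mulrDl mulrDr -scalerAl -scalerAr eu ev.
  by rewrite -!(P_mul (P_rel H_P)) (gT_mulC gT_abelian).
have := P_conj (P_rel H_P) a i; rewrite comm => /eqP.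
rewrite -subr_eq0 -[X in X - _]scale1r -scalerBl scaler_eq0 subr_eq0 eq_sym.
rewrite (negPf (datum_q D i)) /= => /eqP xa.
by rewrite -[x i]mulr1 -(P_one (P_rel H_P)) -(mulgV a) (P_mul (P_rel H_P)) mulrA xa mul0r.
Qed.

Lemma counit_iota g : counit Hh (iota g) = 1.
Proof.
have bil : bilinear (fun h k : H => counit Hh h *: k).
  split=> [k c h h'|h c k k']; first by rewrite linearP scalerDl scalerA.
  by rewrite scalerDr !scalerA mulrC.
have /eqP := counitl Hh (iota g).
rewrite (tensor_sum bil (P_comul_g H_P g)) big_seq1 /= -subr_eq0.
rewrite -[X in _ - X]scale1r -scalerBl => /eqP e.
have /eqP : (counit Hh (iota g) - 1) *: (1 : H) = 0.
  rewrite -(P_one (P_rel H_P)) -(mulgV g) (P_mul (P_rel H_P)) scalerAl e mul0r //.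
by rewrite scaler_eq0 oner_eq0 orbF subr_eq0 => /eqP.
Qed.

Lemma right_inverse (A : algType F) (u : {linear H -> A}) (r : gT -> A) :
  (forall g, u (iota g) * r g = 1 /\ r g * u (iota g) = 1) ->
  exists v : {linear H -> A},
    (forall h, \sum_(p <- comul Hh h) u p.1 * v p.2 = (counit Hh h)%:A)
    /\ forall g, v (iota g) = r g.
Proof.
move=> ur.
pose cond (v : {linear H -> A}) h := \sum_(p <- comul Hh h) u p.1 * v p.2 = (counit Hh h)%:A.
have bil (v : {linear H -> A}) : bilinear (fun h k => u h * v k).
  split=> [k c h h'|h c k k']; first by rewrite linearP mulrDl scalerAl.
  by rewrite linearP mulrDr scalerAr.
have cond_sub v : subspace (cond v).
  split=> [|c h k eh ek]; rewrite /cond.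
    by rewrite (tensor_sum (bil v) comul0) big_nil linear0 scale0r.
  by rewrite (comul_sum_linear Hh (bil v)) eh ek linearP scalerDl scalerA.
have cond_loc (E : H -> Prop) (v v' : {linear H -> A}) : subcoalg Hh E ->
    (forall h, is_iota h -> E h) -> (forall h, E h -> v' h = v h) ->
    forall h, E h -> cond v h -> cond v' h.
  move=> [_ cE] _ vv' h Eh; have [t [Et ht]] := cE _ Eh; rewrite /cond => <-.
  rewrite !(tensor_sum (bil _) ht); apply: eq_big_seq => p /Et[_ E2].
  by rewrite vv'.
have cond_st (E : H -> Prop) (v : {linear H -> A}) M g g' (t : seq (H * H)) :
    subcoalg Hh E -> (forall h, is_iota h -> E h) -> (forall h, E h -> cond v h) ->
    (forall p, p \in t -> E p.1 /\ E p.2) ->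
    tensor_eq (comul Hh M) ((M, g) :: (g', M) :: t) -> is_iota g -> is_iota g' ->
    exists c, forall v' : {linear H -> A},
      (forall h, E h -> v' h = v h) -> v' M = c -> cond v' M.
  move=> cE Ei Ev Et MT [g1 eg1] [g2 eg2]; rewrite eg1 eg2 in MT.
  (* Solves [u M * v g + u g' * v M + ... = counit M] for [v M], where [r g2] is the inverse of
     [u g']. *)
  exists (r g2 * ((counit Hh M)%:A - u M * v (iota g1) - \sum_(p <- t) u p.1 * v p.2)).
  move=> v' v'E v'M; rewrite /cond (tensor_sum (bil v') MT) !big_cons /= v'M mulrA.
  rewrite (ur g2).1 mul1r v'E; last by apply: Ei; exists g1.
  rewrite (_ : \sum_(p <- t) u p.1 * v' p.2 = \sum_(p <- t) u p.1 * v p.2).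
    by rewrite subrK addrC subrK.
  by apply: eq_big_seq => p /Et[_ E2]; rewrite v'E.
have [v0 v0E] := iota_map r.
have g0 : solves_on Hh cond is_iota (span_of is_iota) v0.
  split; [exact: span_iota_subcoalg|by move=> h; apply: span_mem|].
  move=> h hS; have [c0 cL] := cond_sub v0; apply: (span_sub c0 cL _ hS) => z [g ->].
  rewrite /cond (tensor_sum (bil v0) (P_comul_g H_P g)) big_seq1 /= v0E (ur g).1.
  by rewrite counit_iota scale1r.
have iotaP g : is_iota (iota g) by exists g.
have [v [vc vE]] := extend_all H_P iotaP cond_sub cond_loc cond_st g0.
by exists v; split=> // g; rewrite vE ?v0E //; apply: span_mem.
Qed.

(* If [v] is a right inverse of [u] and [w] one of [v], then [w = u]. *)
Lemma conv_invertible (A : algType F) (u : {linear H -> A}) (r : gT -> A) :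
  (forall g, u (iota g) * r g = 1 /\ r g * u (iota g) = 1) ->
  exists v : {linear H -> A}, conv_inverse Hh u v.
Proof.
move=> ur; have [v [uv vE]] := right_inverse ur.
have [|w [vw _]] := @right_inverse A v (fun g => u (iota g)).
  by move=> g; rewrite vE; case: (ur g).
have tri (f1 f2 f3 : {linear H -> A}) :
    [/\ forall v z, linear (fun u => f1 u * f2 v * f3 z),
        forall u z, linear (fun v => f1 u * f2 v * f3 z)
      & forall u v, linear (fun z => f1 u * f2 v * f3 z)].
  split=> [b c k a a'|a c k b b'|a b k c c'].
  - by rewrite linearP !mulrDl -!scalerAl.
  - by rewrite linearP mulrDr mulrDl -!scalerAr -!scalerAl.
  by rewrite linearP mulrDr -!scalerAr.
have wu h : w h = u h.
  have [t1 t2 t3] := tri u v w.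
  have := comulA Hh h t1 t2 t3.
  rewrite !big_allpairs_dep /=.
  under eq_bigr => p _ do rewrite -mulr_suml uv -scalerAl mul1r -linearZ.
  rewrite -linear_sum counitl => ->.
  under eq_bigr => p _.
    under eq_bigr => q _ do rewrite -mulrA.
    rewrite -mulr_sumr vw -scalerAr mulr1 -linearZ.
    over.
  by rewrite -linear_sum counitr.
exists v => h; split; first exact: uv.
by rewrite -[RHS]vw; apply: eq_bigr => p _; rewrite wu.
Qed.

Section Action.
Variables (m : nat).
Local Notation A := 'M[F]_m.+1.
Variable act : H -> A -> A.
Hypothesis act_MA : module_algebra Hh act.

Definition intertwiner (u : {linear H -> A}) h :=
  forall b, u h * b = \sum_(p <- comul Hh h) act p.1 b * u p.2.

Lemma act_bilinear (u : {linear H -> A}) b : bilinear (fun h k => act h b * u k).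
Proof.
split=> [k c h h'|h c k k'].
  by rewrite (act_linearl act_MA) mulrDl scalerAl.
by rewrite linearP mulrDr scalerAr.
Qed.

(** By coassociativity, [sum (h_(1) * b) u(h_(2)) v(h_(3))] can be contracted on either side. *)
Lemma intertwiner_inner (u v : {linear H -> A}) : (forall h, intertwiner u h) ->
  conv_inverse Hh u v -> forall h b, act h b = \sum_(p <- comul Hh h) u p.1 * b * v p.2.
Proof.
move=> iu uv h b.
transitivity (\sum_(p <- comul Hh h) \sum_(q <- comul Hh p.1) act q.1 b * u q.2 * v p.2);
  last by apply: eq_bigr => p _; rewrite iu mulr_suml.
have actl := act_linearl act_MA b.
have := @comulA _ _ Hh h A (fun x y z => act x b * u y * v z).
rewrite !big_allpairs_dep /= => ->.
- under eq_bigr => p _.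
    under eq_bigr => q _ do rewrite -mulrA.
    rewrite -mulr_sumr (uv p.2).1 -scalerAr mulr1 -[act p.1 b]/(mk_linear actl p.1) -linearZ.
    over.
  by rewrite -linear_sum counitr.
- by move=> k l c a a'; rewrite actl !mulrDl -!scalerAl.
- by move=> k l c a a'; rewrite linearP mulrDr mulrDl -!scalerAr -!scalerAl.
by move=> k l c a a'; rewrite linearP mulrDr -!scalerAr.
Qed.

Lemma intertwiner_subspace u : subspace (intertwiner u).
Proof.
split=> [|c h k eh ek] b.
  by rewrite (tensor_sum (act_bilinear u b) comul0) big_nil linear0 mul0r.
rewrite (comul_sum_linear Hh (act_bilinear u b)) -eh -ek linearP mulrDl scalerAl //.
Qed.

Lemma intertwiner_local (E : H -> Prop) (u u' : {linear H -> A}) : subcoalg Hh E ->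
  (forall h, E h -> u' h = u h) ->
  forall h, E h -> intertwiner u h -> intertwiner u' h.
Proof.
move=> [_ cE] uu' h Eh ih b; have [t [Et ht]] := cE _ Eh.
rewrite uu' // ih !(tensor_sum (act_bilinear _ b) ht); apply: eq_big_seq => p /Et[_ E2].
by rewrite uu'.
Qed.

(** At [M] the equation reads [u(M) b = d b + (g' * b) u(M)], where [d] involves known values only
    and is a derivation twisted by the action of [g'], that is, by conjugation with the unit
    [u g']. *)
Lemma intertwiner_step (E : H -> Prop) (u : {linear H -> A}) M g g' (t : seq (H * H)) :
  subcoalg Hh E -> E g -> E g' -> (forall h, E h -> intertwiner u h) ->
  (forall p, p \in t -> E p.1 /\ E p.2) ->
  tensor_eq (comul Hh M) ((M, g) :: (g', M) :: t) ->
  u g' \is a GRing.unit -> (forall b, u g' * b = act g' b * u g') ->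
  exists c, forall u' : {linear H -> A},
    (forall h, E h -> u' h = u h) -> u' M = c -> intertwiner u' M.
Proof.
move=> cE Eg Eg' Eu Et MT Ug' g'E.
pose d b := act M b * u g + \sum_(p <- t) act p.1 b * u p.2.
have actr h := act_linearr act_MA h.
have dl : linear d.
  move=> c b b'; rewrite /d actr mulrDl -scalerAl scalerDr addrACA scaler_sumr -big_split.
  by congr (_ + _); apply: eq_bigr => p _; rewrite actr mulrDl -scalerAl.
have dM b b' : d (b * b') = d b * b' + act g' b * d b'.
  (* The right side of the intertwining equation. At [M] it contains the still arbitrary value
     [u M]; computing [G (b * b') M] in two ways, the terms with [u M] cancel and the Leibniz rule
     for [d] remains. *)
  pose G c k := \sum_(q <- comul Hh k) act q.1 c * u q.2.
  have GE c k : E k -> G c k = u k * c by move=> Ek; rewrite Eu.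
  have GM c : G c M = d c + act g' c * u M.
    rewrite /G (tensor_sum (act_bilinear u c) MT) !big_cons /= /d.
    by rewrite -addrA; congr (_ + _); rewrite addrC.
  have g'M : act g' (b * b') = act g' b * act g' b'.
    by apply: (mulIr Ug'); rewrite -g'E -[RHS]mulrA -g'E !mulrA g'E.
  have bil : bilinear (fun h k => act h b * G b' k).
    split=> [k c h h'|h c k k']; first by rewrite (act_linearl act_MA) mulrDl scalerAl.
    rewrite /G (comul_sum_linear Hh (act_bilinear u b')) mulrDr scalerAr //.
  have : G (b * b') M = \sum_(p <- comul Hh M) act p.1 b * G b' p.2.
    transitivity (\sum_(p <- comul Hh M) \sum_(q <- comul Hh p.1) act q.1 b * act q.2 b' * u p.2).
      by apply: eq_bigr => p _; rewrite (act_prod act_MA) mulr_suml.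
    have := @comulA _ _ Hh M A (fun x y z => act x b * act y b' * u z).
    rewrite !big_allpairs_dep /= => ->.
    - apply: eq_bigr => p _; rewrite mulr_sumr; apply: eq_bigr => q _.
      by rewrite mulrA.
    - by move=> k l c a a'; rewrite (act_linearl act_MA) !mulrDl -!scalerAl.
    - by move=> k l c a a'; rewrite (act_linearl act_MA) mulrDr mulrDl -!scalerAr -!scalerAl.
    by move=> k l c a a'; rewrite linearP mulrDr -!scalerAr.
  rewrite (tensor_sum bil MT) !big_cons /= !GM GE // g'M.
  rewrite (_ : \sum_(p <- t) act p.1 b * G b' p.2 = (\sum_(p <- t) act p.1 b * u p.2) * b').
    rewrite mulrDr mulrA mulrA => e; apply: (addIr (act g' b * act g' b' * u M)).
    by rewrite e [d b]/d mulrDl -!addrA; congr (_ + _); rewrite [RHS]addrC -!addrA.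
  rewrite mulr_suml; apply: eq_big_seq => p /Et[_ E2].
  by rewrite GE // mulrA.
have [c cE'] := skew_derivation_inner dl Ug' g'E dM.
exists c => u' u'E u'M b.
rewrite u'M cE' (tensor_sum (act_bilinear u' b) MT) !big_cons /= u'E // u'M /d.
rewrite -addrA; congr (_ + _); rewrite addrC; congr (_ + _).
by apply: eq_big_seq => p /Et[_ E2]; rewrite u'E.
Qed.

Lemma inner_exists (U : gT -> A) (k : 'I_n) (C : A) : U 1%g = 1 ->
  (forall g, U g \is a GRing.unit) -> (forall g b, U g * b = act (iota g) b * U g) ->
  (forall b, C * b = act (x k) b + act (iota (da D k)) b * C) ->
  exists u : {linear H -> A},
    [/\ inner_via Hh act u, forall g, u (iota g) = U g & u (x k) = C \/ x k = 0].
Proof.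
move=> U1 Uu UE CE.
(* The equation is required only of maps equal to [U] on [G], since a step needs [u g'] to be a unit
   acting by conjugation; extensions keep these values. *)
pose cond (u : {linear H -> A}) h := (forall g, u (iota g) = U g) -> intertwiner u h.
have iotaP g : is_iota (iota g) by exists g.
have cond_sub u : subspace (cond u).
  have [i0 iL] := intertwiner_subspace u.
  by split=> [_ //|c h l eh el uU]; apply: iL; [apply: eh|apply: el].
have cond_loc (E : H -> Prop) (u u' : {linear H -> A}) : subcoalg Hh E ->
    (forall h, is_iota h -> E h) -> (forall h, E h -> u' h = u h) ->
    forall h, E h -> cond u h -> cond u' h.
  move=> cE Ei uu' h Eh ch u'U; apply: (intertwiner_local cE uu' Eh); apply: ch => g.
  by rewrite -u'U uu' //; apply: Ei.
have cond_st (E : H -> Prop) (u : {linear H -> A}) M g g' (t : seq (H * H)) :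
    subcoalg Hh E -> (forall h, is_iota h -> E h) -> (forall h, E h -> cond u h) ->
    (forall p, p \in t -> E p.1 /\ E p.2) ->
    tensor_eq (comul Hh M) ((M, g) :: (g', M) :: t) -> is_iota g -> is_iota g' ->
    exists c, forall u' : {linear H -> A},
      (forall h, E h -> u' h = u h) -> u' M = c -> cond u' M.
  move=> cE Ei Eu Et MT ig ig'.
  have [uU|uU] := classic (forall g, u (iota g) = U g); last first.
    exists 0 => u' u'E _ u'U; case: uU => h; rewrite -u'U u'E //; exact: Ei.
  have Eu' h : E h -> intertwiner u h by move=> Eh; apply: Eu.
  have [c cP] : exists c, forall u' : {linear H -> A},
      (forall h, E h -> u' h = u h) -> u' M = c -> intertwiner u' M.
    apply: (intertwiner_step cE (Ei _ ig) (Ei _ ig') Eu' Et MT).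
      by have [h ->] := ig'; rewrite uU.
    by have [h ->] := ig'; rewrite uU.
  by exists c => u' u'E u'M _; apply: cP.
have [u0 u0U] := iota_map U.
have g0 : solves_on Hh cond is_iota (span_of is_iota) u0.
  split; [exact: span_iota_subcoalg|by move=> h; apply: span_mem|].
  move=> h hS; have [c0 cL] := cond_sub u0; apply: (span_sub c0 cL _ hS) => z [g ->] _ b.
  by rewrite (tensor_sum (act_bilinear u0 b) (P_comul_g H_P g)) big_seq1 /= !u0U.
(* The generator [x k] is adjoined directly after [G], with value [C]; the hypothesis on [C] is the
   intertwining equation for [x_k (x) 1 + a_k (x) x_k]. *)
have [E [u1 [gu1 u1U u1C]]] : exists (E : H -> Prop) (u : {linear H -> A}),
    [/\ solves_on Hh cond is_iota E u, forall g, u (iota g) = U g &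
     (E (x k) /\ u (x k) = C) \/ x k = 0].
  have [kS|kS] := classic (span_of is_iota (x k)).
    by exists (span_of is_iota), u0; split=> //; right; apply: x_span_iota.
  have MT := P_comul_x H_P k; rewrite -(P_one (P_rel H_P)) in MT.
  have [|u' u'E u'M _ b|u' [gu' u'C u'E]] := solves_on_extend_with (c := C) (P_finite H_P)
    cond_sub cond_loc g0 kS _ MT (iotaP _) (iotaP _).
  - by [].
  - rewrite (tensor_sum (act_bilinear u' b) MT) !big_cons big_nil /= u'M addr0.
    by rewrite u'E ?u0U ?U1 ?mulr1 //; apply: span_mem.
  exists (add_line (span_of is_iota) (x k)), u'; split=> //.
    by move=> g; rewrite u'E //; apply: span_mem.
  by left; split=> //; apply: add_line_mem; apply: span_subspace.
have [u [uI uE]] := extend_all H_P iotaP cond_sub cond_loc cond_st gu1.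
have [_ iE _] := gu1.
have uU g : u (iota g) = U g by rewrite uE //; apply: iE.
have [g|v uv] := @conv_invertible A u (fun g => (U g)^-1).
  by rewrite uU divrr ?mulVr.
exists u; split=> //.
  split; first by rewrite -(P_one (P_rel H_P)) uU.
  exists v; split=> //; apply: intertwiner_inner => // h; exact: uI.
by case: u1C => [[Ek <-]|->]; [left; apply: uE|right].
Qed.

End Action.
End Inner.

(** * The block form *)

Section Homogeneous.
Variables (F : closedFieldType) (gT : finGroupType) (n : nat) (D : datum F gT n).
Hypothesis gT_abelian : abelian [set: gT].
Hypothesis char_ndvd : forall p, p \in [pchar F] -> ~~ (p %| #|gT|)%N.
Variables (H : algType F) (Hh : hopf H) (iota : gT -> H) (x : 'I_n -> H).
Hypothesis H_P : is_P D Hh iota x.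
Variables (m : nat).
Local Notation A := 'M[F]_m.+1.
Variable act : H -> A -> A.
Hypothesis act_MA : module_algebra Hh act.

Lemma act_iotaM g b c : act (iota g) (b * c) = act (iota g) b * act (iota g) c.
Proof.
have bil : bilinear (fun h k => act h b * act k c).
  split=> [k a h h'|h a k k']; first by rewrite (act_linearl act_MA) mulrDl scalerAl.
  by rewrite (act_linearl act_MA) mulrDr scalerAr.
by rewrite (act_prod act_MA) (tensor_sum bil (P_comul_g H_P g)) big_seq1.
Qed.

Lemma act_iota_mul g h b : act (iota g) (act (iota h) b) = act (iota (g * h)%g) b.
Proof. by rewrite (P_mul (P_rel H_P)) (act_mul act_MA). Qed.

Lemma act_x_mul k b c :
  act (x k) (b * c) = act (x k) b * c + act (iota (da D k)) b * act (x k) c.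
Proof.
have bil : bilinear (fun h k => act h b * act k c).
  split=> [l a h h'|h a l l']; first by rewrite (act_linearl act_MA) mulrDl scalerAl.
  by rewrite (act_linearl act_MA) mulrDr scalerAr.
rewrite (act_prod act_MA) (tensor_sum bil (P_comul_x H_P k)) !big_cons big_nil /= addr0.
by rewrite (act_one act_MA).
Qed.

Lemma actD h b c : act h (b + c) = act h b + act h c.
Proof. by have := act_linearr act_MA h 1 b c; rewrite !scale1r. Qed.

Lemma act0 h : act h 0 = 0.
Proof. by have := act_linearr act_MA h (-1) 0 0; rewrite scaleN1r addNr scaleN1r addNr. Qed.

Lemma actZ h c b : act h (c *: b) = c *: act h b.
Proof. by have := act_linearr act_MA h c b 0; rewrite act0 !addr0. Qed.

Lemma act_sum h I (r : seq I) (f : I -> A) :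
  act h (\sum_(i <- r) f i) = \sum_(i <- r) act h (f i).
Proof. exact: (big_morph _ (actD h) (act0 h)). Qed.

(* Averaging [chi(g)^-1 (g * C)] over [G] makes a solution [C] homogeneous. *)
Lemma homogeneous_solution (U : gT -> A) (k : 'I_n) :
  (forall g, U g \is a GRing.unit) -> (forall g b, U g * b = act (iota g) b * U g) ->
  exists C, (forall b, C * b = act (x k) b + act (iota (da D k)) b * C) /\
    homogeneous act iota (dchi D k) C.
Proof.
move=> Uu UE; set a := da D k; set chi := dchi D k.
have al h : linear (act h) := act_linearr act_MA h.
have [C0 C0E] := skew_derivation_inner (al (x k)) (Uu a) (UE a) (act_x_mul k).
pose S := \sum_g (chi g)^-1 *: act (iota g) C0.
have c0 : (#|gT|%:R : F) != 0.
  apply/negP => c0; have G0 : (0 < #|gT|)%N by rewrite -cardsT cardG_gt0.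
  have [p pF] := natf0_pchar G0 c0.
  by have /negP[] := char_ndvd pF; rewrite (dvdn_pcharf pF).
have sum1 (b : A) : #|gT|%:R^-1 *: \sum_(g : gT) b = b.
  by rewrite sumr_const -scaler_nat scalerA mulVf // scale1r.
exists (#|gT|%:R^-1 *: S); split.
  (* Apply [g] to the equation for [C0] at [g^-1 * b], using [g x_k g^-1 = chi(g) x_k] and the
     commutativity of [G]. *)
  have e g b : act (iota g) C0 * b = chi g *: act (x k) b + act (iota a) b * act (iota g) C0.
    have e1 : act (iota g) (act (iota g^-1%g) b) = b.
      by rewrite act_iota_mul mulgV (P_one (P_rel H_P)) (act_one act_MA).
    rewrite -{1}e1 -act_iotaM C0E actD act_iotaM !act_iota_mul; congr (_ + _ * _).
      rewrite -(act_mul act_MA) (P_conj (P_rel H_P)).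
      rewrite -[act (_ *: _) _]/(mk_linear (act_linearl act_MA _) _) linearZ /=.
      by rewrite (act_mul act_MA) e1.
    by rewrite (gT_mulC gT_abelian g) mulgK.
  move=> b; rewrite -scalerAl -scalerAr /S mulr_suml mulr_sumr -[act (x k) b]sum1.
  rewrite -scalerDr -big_split; congr (_ *: _); apply: eq_bigr => g _ /=.
  by rewrite -scalerAl e scalerDr scalerA mulVf ?char_neq0 // scale1r scalerAr.
move=> h; rewrite actZ /S act_sum scalerA mulrC -scalerA; congr (_ *: _).
rewrite scaler_sumr [RHS](reindex_inj (mulgI h)) /=; apply: eq_bigr => g _.
rewrite actZ act_iota_mul scalerA Defs.charM invfM mulrA mulfV ?char_neq0 //.
by rewrite mul1r.
Qed.
End Homogeneous.

(** * Homogeneous elements of a matrix algebra over a graded division algebra *)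

Section Graded.
Variables (F : closedFieldType) (gT : finGroupType).
Variables (H A : algType F) (act : H -> A -> A) (iota : gT -> H).
Hypothesis act_linear : forall h, linear (act h).
Variables (D : algType F) (comp : character F gT -> D -> Prop).
Variables (T : {group character F gT}) (X : character F gT -> D).
Variable beta : character F gT -> character F gT -> F.
Hypothesis D_gd : graded_division comp T X beta.
Variable f : gT -> character F gT.
Hypothesis f_T : forall g, f g \in T.
Hypothesis f_beta : forall g, {in T, forall t, beta (f g) t = t g}.
Variables (s : nat) (sigma : 'I_s -> character F gT).
Variables (d : 'I_s -> nat) (Psi : 'M[D]_(\sum_(i < s) d i) -> A).
Hypothesis Psi_id : identification act iota T X sigma Psi.

Local Notation N := (\sum_(i < s) d i)%N.
Local Notation blk a := (@tagnat.sig1 s d a).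

Lemma X_inv t : t \in T -> exists Y, X t * Y = 1 /\ Y * X t = 1.
Proof.
move=> tT; exists (X t ^+ (#[t]%g).-1).
by rewrite -exprS -exprSr prednK ?order_gt0 // (gd_order D_gd).
Qed.

Lemma X_one : X 1%g = 1.
Proof. by have := gd_order D_gd (group1 T); rewrite order1 expr1. Qed.

Lemma f_one : f 1%g = 1%g.
Proof.
apply: (beta_nondeg (gd_beta D_gd)) => // t tT.
by rewrite f_beta // Defs.char1.
Qed.

Lemma decompose (y : D) : exists c : character F gT -> F,
  y = \sum_(t in T) c t *: X t.
Proof.
have [yy [[cyy ->] _]] := comp_direct (gd_grading D_gd) y.
have ex t : exists c : F, t \in T -> yy t = c *: X t.
  have [tT|tT] := boolP (t \in T); last by exists 0.
  by have [c ->] := (gd_comp D_gd tT _).1 (cyy t); exists c.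
have [c cE] := choice ex.
exists c; rewrite (bigID (mem T)) /= [X in _ + X]big1 ?addr0 => [|t tT].
  by apply: eq_bigr => t tT; rewrite cE.
apply: NNPP => y0; case/negP: tT; apply/(gd_support D_gd).
by exists (yy t).
Qed.

Lemma independent (c : character F gT -> F) :
  \sum_(t in T) c t *: X t = 0 -> forall t, t \in T -> c t = 0.
Proof.
move=> c0 t tT.
pose yy := [ffun t => if t \in T then c t *: X t else 0] : {ffun character F gT -> D}.
have [zz [_ uniq]] := comp_direct (gd_grading D_gd) 0.
have comp0 phi : comp phi 0.
  have [w [[cw _] _]] := comp_direct (gd_grading D_gd) 0.
  have := comp_linear (gd_grading D_gd) (-1) (cw phi) (cw phi).
  by rewrite scaleN1r addNr.
have e1 : zz = yy.
  apply: uniq; split=> [phi|].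
    rewrite ffunE; case: ifP => // pT; apply/(gd_comp D_gd pT); by exists (c phi).
  transitivity (\sum_(t in T) c t *: X t); first by rewrite c0.
  rewrite [RHS](bigID (mem T)) /= [X in _ + X]big1 ?addr0 => [|phi pT].
    by apply: eq_bigr => phi pT; rewrite ffunE pT.
  by rewrite ffunE (negPf pT).
have e2 : zz = [ffun=> 0].
  apply: uniq; split=> [phi|]; first by rewrite ffunE.
  by rewrite big1 // => phi _; rewrite ffunE.
have := congr1 (fun w : {ffun character F gT -> D} => w t) (etrans (esym e1) e2).
rewrite !ffunE tT => /eqP; rewrite scaler_eq0 => /orP[/eqP //|/eqP X0].
have [Y [XY _]] := X_inv tT.
by move/eqP: XY; rewrite X0 mul0r eq_sym oner_eq0.
Qed.

Lemma Psi_add M M' : Psi (M + M') = Psi M + Psi M'.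
Proof.
have := Psi_linear Psi_id 1 M M'; rewrite scale1r => <-; congr (Psi (_ + _)).
by apply/matrixP=> i j; rewrite mxE scale1r.
Qed.

Lemma Psi0 : Psi 0 = 0.
Proof. by apply: (addrI (Psi 0)); rewrite -Psi_add !addr0. Qed.

Lemma Psi_scale c M : Psi (map_mx ( *:%R c) M) = c *: Psi M.
Proof. by have := Psi_linear Psi_id c M 0; rewrite Psi0 !addr0. Qed.

Lemma Psi_inj : injective Psi. Proof. exact: bij_inj (Psi_bij Psi_id). Qed.

Lemma matrix_ind_homogeneous (P : 'M[D]_N -> Prop) :
  P 0 -> (forall M M', P M -> P M' -> P (M + M')) ->
  (forall c M, P M -> P (map_mx ( *:%R c) M)) ->
  (forall a b t, t \in T -> P (tens (delta_mx a b) (X t))) -> forall M, P M.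
Proof.
move=> P0 PD PZ Pe M.
have Psum I (r : seq I) (Q : pred I) (h : I -> 'M[D]_N) :
    (forall i, Q i -> P (h i)) -> P (\sum_(i <- r | Q i) h i).
  by move=> Ph; apply: big_ind.
have -> : M = \sum_a \sum_b tens (delta_mx a b) (M a b).
  apply/matrixP=> a b; rewrite summxE (bigD1 a) //= [X in _ + X]big1 ?addr0 => [|a' na].
    rewrite summxE (bigD1 b) //= [X in _ + X]big1 ?addr0 => [|b' nb].
      by rewrite !mxE !eqxx scale1r.
    by rewrite !mxE eqxx /= [b == b']eq_sym (negPf nb) scale0r.
  by rewrite summxE big1 // => b' _; rewrite !mxE [a == a']eq_sym (negPf na) scale0r.
apply: (Psum _ _ _) => a _; apply: (Psum _ _ _) => b _.
have [c ->] := decompose (M a b).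
have -> : tens (delta_mx a b) (\sum_(t in T) c t *: X t) =
    \sum_(t in T) map_mx ( *:%R (c t)) (tens (delta_mx a b) (X t)).
  apply/matrixP=> i j; rewrite summxE !mxE scaler_sumr; apply: eq_bigr => t _.
  by rewrite !mxE !scalerA mulrC.
by apply: (Psum _ _ _) => t tT; apply: PZ; apply: Pe.
Qed.

Definition diagU g : 'M[D]_N :=
  \mxdiag_(i < s) tens ((sigma i g)%:M : 'M[F]_(d i)) (X (f g)).

Lemma diagUE g : diagU g = diag_mx (\row_a (sigma (blk a) g *: X (f g))).
Proof.
have -> : diag_mx (\row_a (sigma (blk a) g *: X (f g))) =
  diag_mx (\mxrow_i (const_mx (sigma i g *: X (f g)) : 'rV_(d i))).
  by congr diag_mx; apply/rowP=> a; rewrite !mxE.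
rewrite diag_mxrow; apply: eq_mxdiag => i; apply/matrixP=> p q; rewrite !mxE.
by case: eqP => _; rewrite ?mulr1n ?mulr0n ?scale0r.
Qed.

Lemma diagU1 : Psi (diagU 1%g) = 1.
Proof.
rewrite diagUE f_one X_one -(Psi_one Psi_id) -diag_const_mx; congr (Psi (diag_mx _)).
by apply/rowP=> a; rewrite !mxE Defs.char1 scale1r.
Qed.

Lemma diagU_unit g : exists V, Psi (diagU g) * V = 1 /\ V * Psi (diagU g) = 1.
Proof.
have [Y [XY YX]] := X_inv (f_T g).
exists (Psi (diag_mx (\row_a ((sigma (blk a) g)^-1 *: Y)))).
rewrite diagUE -!(Psi_mul Psi_id) -(Psi_one Psi_id) !mulmx_diag -diag_const_mx.
split; congr (Psi (diag_mx _)); apply/rowP=> a; rewrite !mxE -scalerAl -scalerAr scalerA.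
  by rewrite mulfV ?char_neq0 // XY scale1r.
by rewrite mulVf ?char_neq0 // YX scale1r.
Qed.

(** On [E_ab (x) X_t], conjugation gives the factor [sigma_a(g) sigma_b(g)^-1 beta(f(g), t)]; as
    [beta(f(g), t) = t(g)], this is the degree evaluated at [g]. *)
Lemma diagU_act g b : Psi (diagU g) * b = act (iota g) b * Psi (diagU g).
Proof.
have [Phi PsiK PhiK] := Psi_bij Psi_id.
have a0 : act (iota g) 0 = 0.
  by have := act_linear (iota g) (-1) 0 0; rewrite scaleN1r addNr scaleN1r addNr.
rewrite -[b]PhiK; move: (Phi b) => M {b}.
apply: (matrix_ind_homogeneous (P := fun M => Psi (diagU g) * Psi M =
  act (iota g) (Psi M) * Psi (diagU g))) => [|M1 M2 e1 e2|c M1 e1|a b t tT].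
- by rewrite Psi0 a0 mulr0 mul0r.
- rewrite Psi_add mulrDr e1 e2.
  by have := act_linear (iota g) 1 (Psi M1) (Psi M2); rewrite !scale1r => ->; rewrite mulrDl.
- rewrite Psi_scale -scalerAr e1.
  by have := act_linear (iota g) c (Psi M1) 0; rewrite a0 !addr0 => ->; rewrite scalerAl.
have := Psi_degree Psi_id (tagnat.sig2 a) (tagnat.sig2 b) tT g.
rewrite !tagnat.sig2K => ->.
rewrite -scalerAl -!(Psi_mul Psi_id) -Psi_scale diagUE; congr Psi.
rewrite mul_diag_mx mul_mx_diag; apply/matrixP=> i j; rewrite !mxE.
case: (eqVneq i a) => [->|_]; last by rewrite !scale0r mulr0 mul0r scaler0.
case: (eqVneq j b) => [->|_]; last by rewrite !scale0r mulr0 mul0r scaler0.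
rewrite !scale1r -scalerAl -scalerAr (gd_comm D_gd (f_T g) tT) f_beta // !scalerA.
congr (_ *: _); rewrite !char_mulE char_invE mulrAC mulfVK ?char_neq0 //.
Qed.

(** Homogeneity says that [diagU g] commutes with [M] up to [chi(g)]. Comparing the coefficients of
    [X_t] in an entry forces [sigma_a t = chi sigma_b] for every [t] that occurs. *)
Lemma homogeneous_entry (chi : character F gT) M : homogeneous act iota chi (Psi M) ->
  forall a b, let tau := ((sigma (blk a))^-1 * sigma (blk b) * chi)%g in
  exists c : F, M a b = if tau \in T then c *: X tau else 0.
Proof.
move=> hM a b tau.
have hMg g : diagU g *m M = map_mx ( *:%R (chi g)) (M *m diagU g).
  by apply: Psi_inj; rewrite Psi_scale !(Psi_mul Psi_id) diagU_act hM scalerAl.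
have [c cE] := decompose (M a b).
have cz t : t \in T -> t != tau -> c t = 0.
  move=> tT tt; apply: NNPP => /eqP ct0; case/eqP: tt.
  have key g : sigma (blk a) g * t g = chi g * sigma (blk b) g.
    have := congr1 (fun N : 'M[D]_N => N a b) (hMg g).
    rewrite diagUE mul_diag_mx mul_mx_diag !mxE cE => e.
    have [Y [XY _]] := X_inv (f_T g).
    (* After both products are ordered as [X_r X_(f g)], the invertible factor [X_(f g)] is
       cancelled, leaving a linear relation among the [X_r]. *)
    pose w (r : character F gT) := (sigma (blk a) g * r g - chi g * sigma (blk b) g) * c r.
    have w0 : \sum_(r in T) w r *: X r = 0.
      rewrite -[LHS]mulr1 -XY mulrA mulr_suml.
      rewrite (_ : \sum_(r in T) _ = (sigma (blk a) g *: X (f g)) * (\sum_(t in T) c t *: X t)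
         - chi g *: ((\sum_(t in T) c t *: X t) * (sigma (blk b) g *: X (f g)))).
        by rewrite e subrr mul0r.
      rewrite mulr_sumr mulr_suml scaler_sumr -sumrB; apply: eq_bigr => r rT.
      rewrite -!scalerAl -!scalerAr (gd_comm D_gd (f_T g) rT) f_beta // !scalerA -scalerBl.
      by congr (_ *: _); rewrite /w; ring.
    have /eqP := independent w0 tT.
    by rewrite mulf_eq0 (negPf ct0) orbF subr_eq0 => /eqP.
  apply: charP => g; rewrite /tau !char_mulE char_invE -mulrA [sigma _ g * _]mulrC -key.
  by rewrite mulrA mulVf ?mul1r // char_neq0.
exists (c tau); rewrite cE; case: ifP => tauT.
  by rewrite (bigD1 tau) //= big1 ?addr0 // => t /andP[tT tt]; rewrite cz // scale0r.
rewrite big1 // => t tT; rewrite cz ?scale0r //.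
by apply: contraFneq tauT => <-.
Qed.

Lemma block_form (chi : character F gT) (M : 'M[D]_N) :
  let tau i j := ((sigma i)^-1 * sigma j * chi)%g in
  (forall a b, exists c : F,
    M a b = if tau (blk a) (blk b) \in T then c *: X (tau (blk a) (blk b)) else 0) ->
  exists2 U : 'I_s -> 'I_s -> 'M[F]_N, forall i j, in_block i j (U i j) &
    M = \sum_(i < s) \sum_(j < s | tau i j \in T) tens (U i j) (X (tau i j)).
Proof.
move=> tau ex; pose c a b := projT1 (cid (ex a b)).
have cE a b : M a b = if tau (blk a) (blk b) \in T then c a b *: X (tau (blk a) (blk b)) else 0.
  exact: projT2 (cid (ex a b)).
exists (fun i j => \matrix_(a, b) (if (blk a == i) && (blk b == j) then c a b else 0)).
  move=> i j k l kl; apply/matrixP=> p q; rewrite !mxE !tagnat.Rank1K ifN //.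
apply/matrixP=> a b; rewrite summxE [RHS](bigD1 (blk a)) //= [X in _ + X]big1 ?addr0 => [|i ia].
  rewrite summxE cE; case: ifP => tT.
    rewrite [RHS](bigD1 (blk b)) //= [X in _ + X]big1 ?addr0 => [|j /andP[_ jb]].
      by rewrite !mxE !eqxx.
    by rewrite !mxE [blk b == j]eq_sym (negPf jb) andbF scale0r.
  rewrite big1 // => j jT; rewrite !mxE eqxx /=; case: eqP => [bj|]; last by rewrite scale0r.
  by move: tT; rewrite bj jT.
by rewrite summxE big1 // => j _; rewrite !mxE [blk a == i]eq_sym (negPf ia) scale0r.
Qed.

Lemma nonzero_block (chi : character F gT) (U : 'I_s -> 'I_s -> 'M[F]_N) k l :
  let tau i j := ((sigma i)^-1 * sigma j * chi)%g in
  (forall i j, in_block i j (U i j)) ->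
  submxblock (\sum_(i < s) \sum_(j < s | tau i j \in T) tens (U i j) (X (tau i j))) k l <> 0 ->
  tau k l \in T.
Proof.
move=> tau Ublk nz; apply: NNPP => /negP tT; apply: nz.
apply/matrixP=> p q; rewrite !mxE summxE big1 // => i _.
rewrite summxE big1 // => j jT; rewrite !mxE.
have kl : (k, l) != (i, j) by apply: contra tT => /eqP[-> ->].
have := congr1 (fun N : 'M[F]_(d k, d l) => N p q) (Ublk i j k l kl).
by rewrite !mxE => ->; rewrite scale0r.
Qed.

End Graded.

Theorem proposition5p11 (F : closedFieldType) (gT : finGroupType)
    (G_abelian : abelian [set: gT])
    (G_nontrivial : (1 < #|gT|)%N)
    (char_ndvd : forall p, p \in [pchar F] -> ~~ (p %| #|gT|)%N)
    (* the Hopf algebra H and the chosen generator x k *)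
    (n : nat) (Dt : datum F gT n)
    (H : algType F) (Hh : hopf H) (iota : gT -> H) (x : 'I_n -> H)
    (H_P : is_P Dt Hh iota x) (k : 'I_n)
    (* the action of H on a matrix algebra *)
    (m : nat) (act : H -> 'M[F]_m.+1 -> 'M[F]_m.+1)
    (act_MA : module_algebra Hh act)
    (* the graded division algebra D *)
    (D : algType F) (comp : character F gT -> D -> Prop)
    (T : {group character F gT}) (X : character F gT -> D)
    (beta : character F gT -> character F gT -> F)
    (D_gd : graded_division comp T X beta)
    (f : gT -> character F gT) (f_T : forall g, f g \in T)
    (f_beta : forall g, {in T, forall t, beta (f g) t = t g})
    (* the graded identification of the matrix algebra with M_d(F) (x) D *)
    (s : nat) (sigma : 'I_s -> character F gT)
    (sigma_ncong : forall i j, i != j -> ((sigma i)^-1 * sigma j)%g \notin T)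
    (d : 'I_s -> nat)
    (Psi : 'M[D]_(\sum_(i < s) d i) -> 'M[F]_m.+1)
    (Psi_id : identification act iota T X sigma Psi)
    (* the grading is mixed *)
    (not_elementary : ~ elementary D)
    (not_division : (\sum_(i < s) d i)%N <> 1%N) :
  let tau i j := ((sigma i)^-1 * sigma j * dchi Dt k)%g in
  exists u : {linear H -> 'M[F]_m.+1},
    [/\ inner_via Hh act u,
        forall g, u (iota g) =
          Psi (\mxdiag_(i < s) tens ((sigma i g)%:M : 'M[F]_(d i)) (X (f g)))
      & exists2 U : 'I_s -> 'I_s -> 'M[F]_(\sum_(i < s) d i),
          forall i j, in_block i j (U i j)
        & let M := \sum_(i < s) \sum_(j < s | tau i j \in T)
                     tens (U i j) (X (tau i j)) in
          [/\ u (x k) = Psi M,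
              forall i j j', submxblock M i j <> 0 -> submxblock M i j' <> 0 ->
                j = j'
            & forall i i' j, submxblock M i j <> 0 -> submxblock M i' j <> 0 ->
                i = i']].
Proof.
move=> tau.
have act_lin := act_linearr act_MA.
pose U g := Psi (diagU X f sigma d g).
have Uu g : U g \is a GRing.unit.
  by apply/unitrP; have [V [UV VU]] := diagU_unit D_gd f_T Psi_id g; exists V.
have UE g b : U g * b = act (iota g) b * U g := diagU_act act_lin D_gd f_T f_beta Psi_id g b.
have U1 : U 1%g = 1 := diagU1 D_gd f_T f_beta Psi_id.
have [C [CE Chom]] := homogeneous_solution G_abelian char_ndvd H_P act_MA k Uu UE.
have [u [uI uU uC]] := inner_exists G_abelian H_P act_MA U1 Uu UE CE.
have [M uM ME] : exists2 M, u (x k) = Psi M &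
    forall a b, exists c : F, M a b = if tau (tagnat.sig1 a) (tagnat.sig1 b) \in T
      then c *: X (tau (tagnat.sig1 a) (tagnat.sig1 b)) else 0.
  (* If [x k = 0], the zero matrix has the required form. *)
  case: uC => [uC|x0]; last first.
    exists 0 => [|a b]; first by rewrite x0 linear0 (Psi0 Psi_id).
    by exists 0; rewrite mxE scale0r if_same.
  have [Phi PsiK PhiK] := Psi_bij Psi_id.
  exists (Phi C); first by rewrite PhiK.
  apply: (homogeneous_entry act_lin D_gd f_T f_beta Psi_id).
  by rewrite PhiK.
have [B Bblk MB] := block_form ME.
exists u; split=> //; exists B => //= ; split; first by rewrite -MB.
- move=> i j j' /(nonzero_block Bblk) ij /(nonzero_block Bblk) ij'.
  apply/eqP; apply: contraT => /sigma_ncong /negP[].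
  (* Two nonzero blocks in a row put both [tau i j] and [tau i j'] in [T], so their quotient would
     make [sigma j] and [sigma j'] congruent modulo [T]. *)
  have -> : ((sigma j)^-1 * sigma j' = (tau i j)^-1 * tau i j')%g.
    by apply: charP => g; rewrite !(char_mulE, char_invE); field; rewrite !char_neq0.
  by rewrite groupM ?groupV.
move=> i i' j /(nonzero_block Bblk) ij /(nonzero_block Bblk) ij'.
apply/eqP; apply: contraT => /sigma_ncong /negP[].
have -> : ((sigma i)^-1 * sigma i' = tau i j * (tau i' j)^-1)%g.
  by apply: charP => g; rewrite !(char_mulE, char_invE); field; rewrite !char_neq0.
by rewrite groupM ?groupV.
Qed.
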